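(* Let $\varphi$ be an admissible function and let $T$ be a sublinear operator acting on measurable functions on $\mathbb{R}^n$ such that, for every $u\in A_1$, $T:L^1(u)\to L^{1,\infty}(u)$ is bounded with constant less than or equal to $\varphi(\|u\|_{A_1})$. Then there is a constant $C>0$ such that, for every $t>0$ and every measurable function $f$, $$(Tf)^*(t)\le C\left(\frac1t\int_0^t f^*(s)\,ds+\int_t^\infty\left(1+\log\frac st\right)^{-1}\varphi\left(1+\log\frac st\right)f^*(s)\,\frac{ds}{s}\right).$$
   Context: A function $\varphi:[1,\infty]\to[1,\infty]$ is called admissible if: (a) $\varphi(1)=1$ and $\varphi$ is log-concave, i.e. $\theta\log\varphi(x)+(1-\theta)\log\varphi(y)\le\log\varphi(\theta x+(1-\theta)y)$ for all $x,y\ge1$ and $0\le\theta\le1$; and (b) there exist $\gamma,\beta>0$ such that $\frac{\gamma}{x}\le\frac{\varphi'(x)}{\varphi(x)}\le\frac{\beta}{x}$ for every $x\ge1$. The Hardy-Littlewood maximal operator on $\mathbb{R}^n$ is $Mf(x)=\sup_{Q\ni x}\frac1{|Q|}\int_Q|f(y)|\,dy$, the supremum being over all cubes $Q$ containing $x$. A weight $u$ (a nonnegative locally integrable function on $\mathbb{R}^n$) belongs to $A_1$ if there is a constant $c$ with $Mu(x)\le c\,u(x)$ for a.e. $x$; $\|u\|_{A_1}$ is the infimum of all such $c$. $L^1(u)$ and $L^{1,\infty}(u)$ are the Lebesgue and weak Lebesgue spaces for the measure $u(x)\,dx$, with $\|g\|_{L^{1,\infty}(u)}=\sup_{y>0}y\,u(\{|g|>y\})$.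 The decreasing rearrangement with respect to Lebesgue measure is $f^*(t)=\inf\{s>0:|\{|f|>s\}|\le t\}$.
   Formalization: The bound is proved for measurable f lying in L^1(u) for some u in A_1, not for every measurable f; outside that union the hypotheses do not constrain Tf and the claim can fail, e.g. for f=(1+log(1+|x|))^{-A} with A large. *)

(* Defs.v *)
From HB Require Import structures.
From mathcomp Require Import all_boot all_order all_algebra.
From mathcomp Require Import all_classical all_reals all_analysis.
From mathcomp Require Import measurable_realfun.
Import Order.TTheory GRing.Theory Num.Theory.
Import numFieldNormedType.Exports.

Set Implicit Arguments.
Unset Strict Implicit.
Unset Printing Implicit Defensive.

Local Open Scope classical_set_scope.
Local Open Scope ring_scope.

Definition rV_display : measure_display -> measure_display.
Proof. exact. Qed.

Section borel_rV.
Variables (R : realType) (n : nat).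

Definition rV_coord (i : 'I_n) (x : 'rV[R]_n) : measurableTypeR R := x ord0 i.

Let rV_set0 : g_sigma_preimage rV_coord set0.
Proof. exact: sigma_algebra0. Qed.

Let rV_setC A : g_sigma_preimage rV_coord A -> g_sigma_preimage rV_coord (~` A).
Proof. exact: sigma_algebraC. Qed.

Let rV_bigcup (F : (set 'rV[R]_n)^nat) :
  (forall i, g_sigma_preimage rV_coord (F i)) ->
  g_sigma_preimage rV_coord (\bigcup_i (F i)).
Proof. exact: sigma_algebra_bigcup. Qed.

(* The product of n copies of the Borel sigma-algebra of R. *)
HB.instance Definition _ := @isMeasurable.Build
  (rV_display default_measure_display)
  'rV[R]_n (g_sigma_preimage rV_coord) rV_set0 rV_setC rV_bigcup.

Lemma measurable_rV_coord (i : 'I_n) :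
  measurable_fun [set: 'rV[R]_n] (rV_coord i).
Proof.
move=> _ Y mY; rewrite setTI; apply: sub_sigma_algebra => /=.
rewrite -bigcup_seq/=; exists i => /=; first by rewrite mem_index_enum.
by exists Y => //; rewrite setTI.
Qed.

Lemma measurable_fun_rV d (T : measurableType d) (f : T -> 'rV[R]_n) :
  (forall i, measurable_fun [set: T] (rV_coord i \o f)) ->
  measurable_fun [set: T] f.
Proof.
move=> mf.
have sub : g_sigma_preimage (fun i => rV_coord i \o f) `<=` measurable.
  apply: smallest_sub; first exact: sigma_algebra_measurable.
  by rewrite -bigcup_seq => A [i _ [B mB <-]]; exact: mf.
rewrite g_sigma_preimage_comp in sub.
by move=> _ A mA; apply: sub; exists A.
Qed.

End borel_rV.

Section cons_measure.
Variables (R : realType) (n : nat).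

Definition rV_cons (p : measurableTypeR R * 'rV[R]_n) : 'rV[R]_n.+1 :=
  \row_i (if unlift ord0 i is Some j then p.2 ord0 j else p.1).

Definition rV_uncons (x : 'rV[R]_n.+1) : measurableTypeR R * 'rV[R]_n :=
  (x ord0 ord0, \row_j x ord0 (lift ord0 j)).

Lemma rV_consK : cancel rV_cons rV_uncons.
Proof.
case=> a v; rewrite /rV_uncons /rV_cons mxE unlift_none /=; congr pair.
by apply/rowP => j; rewrite !mxE liftK.
Qed.

Lemma measurable_rV_cons : measurable_fun setT rV_cons.
Proof.
apply: measurable_fun_rV => i.
have [j ij|i0] := unliftP ord0 i.
  rewrite (_ : _ \o _ = rV_coord j \o snd).
    by apply: measurableT_comp => //; exact: measurable_rV_coord.
  by apply/funext => p; rewrite /rV_coord /= mxE ij liftK.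
rewrite (_ : _ \o _ = fst); first exact: measurable_fst.
by apply/funext => p; rewrite /rV_coord /= mxE i0 unlift_none.
Qed.

Lemma measurable_rV_uncons : measurable_fun setT rV_uncons.
Proof.
apply/measurable_fun_pairP; split.
  exact: (measurable_rV_coord (ord0 : 'I_n.+1)).
apply: measurable_fun_rV => i.
rewrite (_ : _ \o _ = rV_coord (lift ord0 i)); first exact: measurable_rV_coord.
by apply/funext => p; rewrite /rV_coord /= mxE.
Qed.

Variable m : {sigma_finite_measure set 'rV[R]_n -> \bar R}.

Definition cons_measure : set 'rV[R]_n.+1 -> \bar R :=
  pushforward (lebesgue_measure \x m)%E rV_cons.

Let cons_measure0 : cons_measure set0 = 0%E.
Proof. by apply: measure0; exact: measurable_rV_cons. Qed.

Let cons_measure_ge0 A : (0 <= cons_measure A)%E.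
Proof. by apply: measure_ge0; exact: measurable_rV_cons. Qed.

Let cons_measure_sigma_additive : semi_sigma_additive cons_measure.
Proof.
by apply: measure_semi_sigma_additive; exact: measurable_rV_cons.
Qed.

HB.instance Definition _ := isMeasure.Build _ _ _ cons_measure
  cons_measure0 cons_measure_ge0 cons_measure_sigma_additive.

Let cons_measure_sigma_finite : sigma_finite setT cons_measure.
Proof.
have /sigma_finiteP[F [FT ndF mF]] := sigma_finiteT (@lebesgue_measure R).
have /sigma_finiteP[G [GT ndG mG]] := sigma_finiteT m.
exists (fun k => rV_uncons @^-1` (F k `*` G k)).
  apply/esym; rewrite -subTset => x _.
  have [/= i _ Fi] : (\bigcup_i F i) (rV_uncons x).1 by rewrite -FT.
  have [/= j _ Gj] : (\bigcup_j G j) (rV_uncons x).2 by rewrite -GT.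
  exists (maxn i j) => //; split.
    by move: Fi; exact/subsetPset/ndF/leq_maxl.
  by move: Gj; exact/subsetPset/ndG/leq_maxr.
move=> k; have [mFk Fk] := mF k; have [mGk Gk] := mG k; split.
  rewrite -[X in measurable X]setTI; apply: measurable_rV_uncons => //.
  exact: measurableX.
rewrite /cons_measure /pushforward -comp_preimage.
rewrite (_ : rV_uncons \o rV_cons = id); last first.
  by apply/funext => p; exact: rV_consK.
rewrite preimage_id product_measure1E//.
by rewrite lte_mul_pinfty// ge0_fin_numE.
Qed.

HB.instance Definition _ :=
  Measure_isSigmaFinite.Build _ _ _ cons_measure cons_measure_sigma_finite.

End cons_measure.

(* The n-dimensional Lebesgue measure on Borel sets: the product of n copies of
   [lebesgue_measure] *)
Fixpoint borel_measure (R : realType) (n : nat) :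
    {sigma_finite_measure set 'rV[R]_n -> \bar R} :=
  match n with
  | 0 => \d_(0 : 'rV[R]_0)
  | m.+1 => @cons_measure R m (borel_measure R m)
  end.

(* R^n carrying its Lebesgue measurable sets: the Caratheodory-measurable sets of
   the outer measure induced by [borel_measure] *)
Definition Rn (R : realType) (n : nat) : measurableType _ :=
  caratheodory_type ((borel_measure R n)^*)%mu.

Definition vol (R : realType) (n : nat) : set (Rn R n) -> \bar R :=
  @completed_measure_extension _ _ _ (borel_measure R n).
Arguments vol : clear implicits.

HB.instance Definition _ (R : realType) (n : nat) := Measure.on (vol R n).

Lemma vol_sigma_finite (R : realType) (n : nat) : sigma_finite setT (vol R n).
Proof.
apply: completed_measure_extension_sigma_finite.
exact: (sigma_finiteT (borel_measure R n)).
Qed.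

HB.instance Definition _ (R : realType) (n : nat) :=
  Measure_isSigmaFinite.Build _ _ _ (vol R n) (@vol_sigma_finite R n).

Section weights.
Variables (R : realType) (n : nat).
Local Open Scope ereal_scope.

Local Notation E := (Rn R n).
Local Notation mu := (vol R n).

(* Cubes with sides parallel to the axes, closed. *)
Definition cube (a : 'rV[R]_n) (l : R) : set E :=
  [set x : 'rV[R]_n |
    forall i, (a ord0 i <= x ord0 i <= a ord0 i + l)%R].

Definition maximal (f : E -> R) (x : E) : \bar R :=
  ereal_sup [set (fine (mu Q))^-1%:E * \int[mu]_(y in Q) `|f y|%:E |
    Q in [set Q | exists a l, [/\ (0 < l)%R, Q = cube a l & Q x]]].

Definition weight (u : E -> R) : Prop :=
  [/\ measurable_fun [set: E] u, forall x, (0 <= u x)%R &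
      forall K : set 'rV[R]_n, compact K ->
        \int[mu]_(x in (K : set E)) `|u x|%:E < +oo].

Definition A1_bound (u : E -> R) (c : R) : Prop :=
  {ae mu, forall x, maximal u x <= (c * u x)%:E}.

(* The zero weight is excluded: its infimum of constants is not in [1, +oo[. *)
Definition A1 (u : E -> R) : Prop :=
  [/\ weight u, ~ {ae mu, forall x, u x = 0%R} & exists c, A1_bound u c].

Definition A1_norm (u : E -> R) : \bar R :=
  ereal_inf (EFin @` [set c | A1_bound u c]).

(* The measure u(x) dx. *)
Definition wmeasure (u : E -> R) (A : set E) : \bar R :=
  \int[mu]_(x in A) (u x)%:E.

Definition L1_norm (u f : E -> R) : \bar R := \int[mu]_x (`|f x| * u x)%:E.

Definition weak_L1_norm (u : E -> R) (g : E -> \bar R) : \bar R :=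
  ereal_sup [set y%:E * wmeasure u [set x | y%:E < `|g x|] |
    y in [set y | (0 < y)%R]].

(* Decreasing rearrangement with respect to Lebesgue measure. *)
Definition rearr (g : E -> \bar R) (t : R) : \bar R :=
  ereal_inf (EFin @`
    [set s | (0 < s)%R /\ mu [set x | s%:E < `|g x|] <= t%:E]).

(* The union of the spaces L^1(u), u in A_1: the functions on which an operator
   bounded from L^1(u) to L^{1,oo}(u) for every u in A_1 is defined. *)
Definition A1_domain (f : E -> R) : Prop :=
  measurable_fun [set: E] f /\ exists2 u, A1 u & L1_norm u f < +oo.

(* Measurable functions are identified when they agree almost everywhere, and
   [T f] may take infinite values (as the maximal operator does). *)
Definition sublinear (T : (E -> R) -> (E -> \bar R)) : Prop :=
  [/\ forall f, A1_domain f -> measurable_fun [set: E] (T f),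
      forall f g, A1_domain f -> A1_domain g ->
        {ae mu, forall x, `|T (f \+ g)%R x| <= `|T f x| + `|T g x|} &
      forall (c : R) f, A1_domain f ->
        {ae mu, forall x, `|T (fun y => c * f y)%R x| = `|c|%:E * `|T f x|}].

Definition A1_weak_bounded (T : (E -> R) -> (E -> \bar R))
    (phi : \bar R -> \bar R) : Prop :=
  forall u, A1 u -> forall f : E -> R, measurable_fun [set: E] f ->
    L1_norm u f < +oo ->
    weak_L1_norm u (T f) <= phi (A1_norm u) * L1_norm u f.

End weights.

(* [d] is the derivative at [x] of the restriction of [f] to [1, +oo[, hence a
   one-sided derivative when [x = 1] *)
Definition is_derive_ge1 (R : realType) (f : R -> R) (x d : R) : Prop :=
  (f y - f x) / (y - x) @[y --> within `[1, +oo[ x^'] --> d.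

Section admissible.
Variable R : realType.
Local Open Scope ereal_scope.

Definition log_concave (phi : \bar R -> \bar R) : Prop :=
  forall (x y : \bar R) (th : R), 1 <= x -> 1 <= y -> (0 <= th <= 1)%R ->
    th%:E * lne (phi x) + (1 - th)%:E * lne (phi y) <=
    lne (phi (th%:E * x + (1 - th)%:E * y)).

Definition admissible (phi : \bar R -> \bar R) : Prop :=
  [/\ forall x, 1 <= x -> 1 <= phi x,
      phi 1 = 1,
      log_concave phi &
      exists gamma beta : R, [/\ (0 < gamma)%R, (0 < beta)%R &
        forall x : R, (1 <= x)%R -> phi x%:E \is a fin_num /\
          exists d : R, is_derive_ge1 (fine \o phi \o EFin) x d /\
            (gamma / x <= d / fine (phi x%:E) <= beta / x)%R]].

End admissible.

(* Main.v *)
(* Let F have measure tau and let L >= 1.  Rubio de Francia's sum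
     u = sum_j B^-j M^j 1_F,   B of order L,
   is an A_1 weight with constant at most B and u >= 1_F, and iterating the weak
   type (1,1) inequality of M along dyadic levels gives u(A) <= 10 tau for every A
   of measure at most 2^L tau.  If g is bounded by lam and supported in such an A,
   the weighted estimate for u, with F inside {|Tg| > y}, therefore yields
     |{|Tg| > y}| <= tau   as soon as   y > 10 phi(B) lam:
   no logarithm is lost.  Now cut f at the heights f*(s_k), s_k = t 2^(2^k - 1).
   The layer f*(s_(k+1)) < |f| <= f*(s_k) is treated with tau = t 2^-(k+3) and
   L = 2^(k+3), and costs a multiple of phi(2^k) f*(s_k), which is dominated by
   the second integral over log (s / t) of order 2^k; the part |f| > f*(t) is
   treated with L = 1 and gives the first integral.  What is left below f*(s_N)
   tends to 0 in L^1(w) for the weight w in A_1 with f in L^1(w), hence T of it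
   tends to 0 in measure on sets of finite measure. *)

Require Import Defs.
From mathcomp Require Import all_boot all_order all_algebra.
From mathcomp Require Import all_classical all_reals all_analysis.
From mathcomp Require Import measurable_realfun.
From mathcomp Require Import zify ring lra.
Import Order.TTheory GRing.Theory Num.Theory.
Import numFieldNormedType.Exports.

Set Implicit Arguments.
Unset Strict Implicit.
Unset Printing Implicit Defensive.

Local Open Scope classical_set_scope.
Local Open Scope ring_scope.
Local Open Scope ereal_scope.

(** * Cubes and the maximal operator *)

(** Two demands fix the order of B. On L^p the norm of M grows like 1/(p - 1) as p tends to 1, and B
    must exceed it for the series of iterates to converge; passing from an L^p bound to an integral
    over a set of measure 2^L tau costs a power 2^(L(1 - 1/p)), which stays bounded only if p - 1 is
    of order 1/L. Writing q = 2^(1 - p) and measuring functions on dyadic levels avoids real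
    exponents: q = 1 - 1/(2L) has 1/(1 - q) = 2L and q^L >= 1/2. The heights are doubly exponential
    because, in the variable v = log(s/t), the second integral has density phi(v)/v: a block where v
    is of order 2^k has weight of order phi(2^k), exactly the price of one layer. The multiplicative
    constants inside phi are absorbed by doubling. Subadditivity of T applies to finite sums only,
    and no continuity of T is assumed. The decomposition therefore stops at a finite N, and the
    remainder needs an argument of its own. *)

Lemma measurable_Rn (R : realType) (n : nat) (A : set 'rV[R]_n) :
  measurable A -> measurable (A : set (Rn R n)).
Proof. exact: caratheodory_measurable_mu_ext. Qed.

Lemma vol_borel (R : realType) (n : nat) (A : set 'rV[R]_n) :
  measurable A -> vol R n A = borel_measure R n A.
Proof. exact: measurable_mu_extE. Qed.

Lemma measurable_cube_rV (R : realType) (n : nat) (a : 'rV[R]_n) (l : R) :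
  measurable (cube a l : set 'rV[R]_n).
Proof.
rewrite (_ : cube a l = \bigcap_(i in [set: 'I_n])
    (@rV_coord R n i @^-1` `[a ord0 i, (a ord0 i + l)%R])); last first.
  apply/seteqP; split=> x /=.
    by move=> H i _; rewrite /= in_itv /=; exact: H.
  by move=> H i; have := H i I; rewrite /= in_itv.
apply: fin_bigcap_measurable => // i _.
rewrite -[X in measurable X]setTI.
by apply: measurable_rV_coord => //; exact: measurable_itv.
Qed.

Lemma measurable_cube (R : realType) (n : nat) (a : 'rV[R]_n) (l : R) :
  measurable (cube a l).
Proof. exact: (@measurable_Rn R n _ (measurable_cube_rV a l)). Qed.

Lemma vol_cube (R : realType) (n : nat) (a : 'rV[R]_n) (l : R) :
  (0 <= l)%R -> vol R n (cube a l) = (l ^+ n)%:E.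
Proof.
move=> l0; rewrite vol_borel; last exact: measurable_cube_rV.
elim: n a => [|n IHn] a /=.
  have Q0 : (cube a l : set 'rV[R]_0) 0%R by case.
  by rewrite expr0 diracE mem_set.
rewrite /cons_measure /pushforward.
rewrite (_ : _ @^-1` _ =
    `[a ord0 ord0, (a ord0 ord0 + l)%R] `*`
    (cube (\row_j a ord0 (lift ord0 j)) l : set 'rV[R]_n)); last first.
  apply/seteqP; split=> -[x v] /=.
    move=> H; split=> /=.
      by have := H ord0; rewrite /rV_cons mxE unlift_none in_itv.
    by move=> i; have := H (lift ord0 i); rewrite /rV_cons !mxE liftK.
  move=> [/= H1 H2] i; rewrite /rV_cons mxE.
  have [j ->|->] := unliftP ord0 i; last by move: H1; rewrite in_itv.
  by have := H2 j; rewrite mxE.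
rewrite product_measure1E//; last exact: measurable_cube_rV.
by rewrite /= IHn lebesgue_measure_itv/= lte_fin ltrDl exprS EFinM; case: ltrgt0P l0 => // [_|->] _; rewrite -?EFinD ?mul0r ?mul0e// addrAC subrr add0r.
Qed.

(* Unlike the library's [ge0_le_integral], no measurability is required: the
   integral of a nonnegative function is a supremum over simple functions. *)
Lemma ge0_le_integral_nomeas d (T : measurableType d) (R : realType)
    (mu : {measure set T -> \bar R}) (D1 D2 : set T) (f1 f2 : T -> \bar R) :
  D1 `<=` D2 -> (forall x, D2 x -> 0 <= f2 x) ->
  (forall x, D1 x -> 0 <= f1 x) ->
  (forall x, D1 x -> f1 x <= f2 x) ->
  \int[mu]_(x in D1) f1 x <= \int[mu]_(x in D2) f2 x.
Proof.
move=> D12 f20 f10 f12.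
rewrite integral_mkcond [leRHS]integral_mkcond.
have g10 x : 0 <= (f1 \_ D1) x by rewrite patchE; case: ifPn => // /set_mem/f10.
have g20 x : 0 <= (f2 \_ D2) x by rewrite patchE; case: ifPn => // /set_mem/f20.
rewrite !ge0_integralTE//; apply: le_ereal_sup => _ [h hf1 <-]; exists h => //.
move=> x; apply: (le_trans (hf1 x)).
rewrite [leLHS]patchE [leRHS]patchE; case: ifPn => [/set_mem D1x|_].
  by rewrite mem_set; [exact: f12|exact: D12].
by case: ifPn => // /set_mem/f20.
Qed.

(** The countable family of cubes through which the level sets of M become measurable and are
    exhausted by finite unions. *)
Definition ratcube (R : realType) (n : nat) (p : 'rV[rat]_n * rat) : set (Rn R n) :=
  cube (\row_i ratr (p.1 ord0 i)) (ratr p.2).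
Arguments ratcube R {n} p.

(** Each coordinate of the corner moves down by less than half of the slack [l' - l]; a side
    exceeding [l] by more than that half still reaches past the far faces. *)
Lemma cube_sub_ratcube (R : realType) (n : nat) (a : 'rV[R]_n) (l l' : R) :
  (0 < l < l')%R -> exists p : 'rV[rat]_n * rat,
    [/\ (0 < p.2)%R, (l < ratr p.2 < l')%R & cube a l `<=` ratcube R p].
Proof.
move=> /andP[l0 ll']; pose e := ((l' - l) / 2)%R.
have e0 : (0 < e)%R by rewrite /e; lra.
have H i : exists q : rat, ratr q \in `]a ord0 i - e, a ord0 i[%R.
  by apply: rat_in_itvoo; lra.
have /rat_in_itvoo[q] : (l + e < l')%R by rewrite /e; lra.
rewrite in_itv/= => /andP[q1 q2].
have [f Hf] := choice H.
exists (\row_i f i, q); split => //=.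
  - by rewrite -(ltr0q R); lra.
  - by apply/andP; split; lra.
move=> x xQ i; rewrite !mxE/=; have := Hf i; rewrite in_itv/= => /andP[h1 h2].
by have /andP[h3 h4] := xQ i; apply/andP; split; lra.
Qed.

Section maximal.
Variables (R : realType) (n : nat).
Local Notation E := (Rn R n).
Local Notation mu := (vol R n).
Implicit Types (g h : E -> R) (x : E).

Lemma lt_maximalP g x (y : R) :
  (y%:E < maximal g x) <-> exists a l, [/\ (0 < l)%R, cube a l x &
    (y * l ^+ n)%:E < \int[mu]_(z in cube a l) `|g z|%:E].
Proof.
have key a l : (0 < l)%R ->
    (y%:E < (fine (mu (cube a l)))^-1%:E * \int[mu]_(z in cube a l) `|g z|%:E) =
    ((y * l ^+ n)%:E < \int[mu]_(z in cube a l) `|g z|%:E).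
  move=> l0; rewrite vol_cube ?(ltW l0)//= EFinM.
  have ln0 : (0 < l ^+ n)%R by rewrite exprn_gt0.
  by rewrite [in LHS]muleC lte_pdivlMr.
split=> [|[a [l [l0 Qx yQ]]]].
  move=> /ereal_sup_gt[_ [Q [a [l [l0 -> Qx]]] <-]] H.
  by exists a, l; split => //; rewrite -key.
rewrite -key// in yQ; apply: (lt_le_trans yQ); apply: ereal_sup_ubound.
by exists (cube a l) => //; exists a, l.
Qed.

Lemma cube_center x : cube (\row_i ((x : 'rV_n) ord0 i)) 1 x.
Proof. by move=> i; rewrite mxE; lra. Qed.

Lemma maximal_ge0 g x : 0 <= maximal g x.
Proof.
apply: le_trans (ereal_sup_ubound _); last first.
  exists (cube (\row_i ((x : 'rV_n) ord0 i)) 1%R) => //.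
  by exists (\row_i ((x : 'rV_n) ord0 i)), 1%R; split => //; exact: cube_center.
rewrite mule_ge0// ?lee_fin ?invr_ge0 ?fine_ge0//.
by apply: integral_ge0 => z _; rewrite lee_fin.
Qed.

(* By monotone enlargement, cubes with rational corners and sides suffice. *)
Lemma gt_maximal_ratcube g (y : R) :
  [set x | y%:E < maximal g x] = \bigcup_(p in [set p | (0 < p.2)%R /\
    (y * (ratr p.2) ^+ n)%:E < \int[mu]_(z in ratcube R p) `|g z|%:E])
    ratcube R p.
Proof.
apply/seteqP; split=> x /=; last first.
  move=> [[a l] [/= l0 yQ] Qx]; apply/lt_maximalP.
  by exists (\row_i ratr (a ord0 i)), (ratr l); split => //; rewrite ltr0q.
move=> /lt_maximalP[a [l [l0 Qx yQ]]].
(* The inequality is strict and [y * l' ^+ n] is continuous in [l'], so the side may grow a little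
   while the integral is kept over the original cube. *)
have [e e0 eP] : exists2 e : R, (0 < e)%R & forall l', (l <= l' <= l + e)%R ->
    (y * l' ^+ n)%:E < \int[mu]_(z in cube a l) `|g z|%:E.
  have : \forall l' \near l,
      (y * l' ^+ n)%:E < \int[mu]_(z in cube a l) `|g z|%:E.
    move: yQ; case: (\int[mu]_(z in cube a l) `|g z|%:E) => [r| |//]; last first.
      by move=> _; near=> l'; rewrite ltry.
    rewrite lte_fin => yr.
    have /cvgr_lt : (fun z => y * z ^+ n)%R @ l --> (y * l ^+ n)%R.
      by apply: cvgM; [exact: cvg_cst|exact: exprn_continuous].
    by move=> /(_ _ yr); apply: filterS => z; rewrite lte_fin.
  move=> /nbhs_ballP[e/= e0 He]; exists (e / 2)%R; first by rewrite divr_gt0.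
  move=> l' /andP[h1 h2]; apply: He; rewrite /ball/= distrC ger0_norm; lra.
have lle : (0 < l < l + e)%R by rewrite l0/= ltrDl.
have [p [p0 pl ap]] := cube_sub_ratcube a lle.
exists p; last exact: ap.
split => //; apply: (@lt_le_trans _ _ (\int[mu]_(z in cube a l) `|g z|%:E)).
  by apply: eP; case/andP: pl => /ltW -> /ltW ->.
by apply: ge0_le_integral_nomeas => // z _; rewrite lee_fin.
Unshelve. all: by end_near.
Qed.
End maximal.

(** * The weak type (1,1) inequality for M *)

Section weak_type.
Variables (R : realType) (n : nat).
Local Notation E := (Rn R n).
Local Notation mu := (vol R n).
Implicit Types (g h : E -> R) (x : E).

Lemma measurable_maximal g : measurable_fun setT (maximal g).
Proof.
apply: (measurability _ (ErealGenOInfty.measurableE R)) => _ [_ [y ->] <-].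
rewrite setTI (_ : _ @^-1` _ = [set x | y%:E < maximal g x]); last first.
  by apply/seteqP; split=> x /=; rewrite in_itv/= andbT.
rewrite gt_maximal_ratcube bigcup_mkcond; apply: countable_bigcupT_measurable.
  exact: countableP.
by move=> p; case: ifPn => // _; exact: measurable_cube.
Qed.

Lemma exists_maxr (I : eqType) (s : seq I) (F : I -> R) : s != [::] ->
  exists2 i, i \in s & forall j, j \in s -> (F j <= F i)%R.
Proof.
elim: s => // a [_ _|b s /(_ isT)[i is_ Hi] _].
  by exists a; rewrite ?mem_head// => j; rewrite inE => /eqP ->.
have [ai|ia] := leP (F a) (F i).
  by exists i => [|j]; rewrite inE ?is_ ?orbT// => /predU1P[->//|/Hi].
exists a => [|j]; rewrite ?mem_head// inE => /predU1P[->//|/Hi ji].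
exact: (le_trans ji (ltW ia)).
Qed.

Let Q p : set E := cube p.1 p.2.

Let mQ (s : seq ('rV[R]_n * R)) : measurable (\bigcup_(p in [set` s]) Q p).
Proof.
by apply: fin_bigcup_measurable => [|p _]; [exact: finite_seq|exact: measurable_cube].
Qed.

Lemma cube_triple p q : Q p `&` Q q !=set0 -> (p.2 <= q.2)%R ->
  Q p `<=` cube (q.1 - const_mx q.2)%R (3 * q.2)%R.
Proof.
move=> [z [pz qz]] pq x px i.
have /andP[h1 h2] := pz i; have /andP[h3 h4] := qz i.
by have /andP[h5 h6] := px i; rewrite !mxE; apply/andP; split; lra.
Qed.

(* Vitali's covering argument: a largest cube, tripled, swallows every cube that
   it meets; the remaining cubes are disjoint from it. *)
Lemma vitali_weak_type g (y : R) (s : seq ('rV[R]_n * R)) :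
  measurable_fun setT g -> (0 <= y)%R ->
  (forall p, p \in s -> (0 < p.2)%R /\
    (y * p.2 ^+ n)%:E <= \int[mu]_(z in Q p) `|g z|%:E) ->
  y%:E * mu (\bigcup_(p in [set` s]) Q p) <=
  (3 ^+ n)%:E * \int[mu]_(z in \bigcup_(p in [set` s]) Q p) `|g z|%:E.
Proof.
move=> mg y0.
have mabs (D : set E) : measurable_fun D (fun z => `|g z|%:E).
  by apply/measurable_EFinP; apply: measurableT_comp => //; exact: measurable_funTS.
have [m] := ubnP (size s); elim: m s => // m IHm s sm sP.
have [->|/exists_maxr-/(_ snd)[q qs qmax]] := eqVneq s [::].
  rewrite (_ : \bigcup_(p in _) Q p = set0) ?measure0 ?integral_set0 ?mule0//.
  by apply/seteqP; split => // x [].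
have [q0 qy] := sP _ qs.
pose s' := [seq p <- s | `[< Q p `&` Q q = set0 >]].
have s's p : p \in s' -> p \in s by rewrite mem_filter => /andP[].
have qs' : q \notin s'.
  rewrite mem_filter negb_and; apply/orP; left; apply/asboolPn => qq.
  have : (Q q `&` Q q) q.1 by split => i; rewrite lexx/= lerDl ltW.
  by rewrite qq.
have {IHm} : y%:E * mu (\bigcup_(p in [set` s']) Q p) <=
    (3 ^+ n)%:E * \int[mu]_(z in \bigcup_(p in [set` s']) Q p) `|g z|%:E.
  apply: IHm; last by move=> p /s's; exact: sP.
  rewrite -ltnS; apply: leq_trans sm; rewrite ltnS size_filter.
  rewrite -(count_predC (fun p => `[< Q p `&` Q q = set0 >]) s) -[X in (X < _)%N]addn0.
  rewrite ltn_add2l -has_count; apply/hasP; exists q => //=.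
  by apply: contra qs' => qq; rewrite mem_filter qq.
set U := \bigcup_(p in [set` s]) Q p; set U' := \bigcup_(p in [set` s']) Q p.
move=> IH.
have U'U : U' `<=` U by move=> x [p /= /s's ps Qx]; exists p.
have QU : Q q `<=` U by move=> x Qx; exists q.
have subU : U `<=` cube (q.1 - const_mx q.2)%R (3 * q.2)%R `|` U'.
  move=> x [p /= ps Qx].
  have [pq|pq] := pselect (Q p `&` Q q = set0).
    by right; exists p => //=; rewrite mem_filter ps andbT; exact/asboolP.
  left; apply: (@cube_triple p) => //; last exact: qmax.
  by apply/set0P/eqP.
have mC : measurable (cube (q.1 - const_mx q.2)%R (3 * q.2)%R : set E).
  exact: measurable_cube.
apply: (@le_trans _ _ (y%:E * (mu (cube (q.1 - const_mx q.2)%R (3 * q.2)%R) + mu U'))).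
  apply: lee_wpmul2l; first by rewrite lee_fin.
  apply: le_trans (measureU2 _ mC (mQ s')).
  by apply: le_measure => //; rewrite inE; [exact: mQ|exact: measurableU].
rewrite ge0_muleDr//.
apply: (@le_trans _ _ ((3 ^+ n)%:E * (\int[mu]_(z in Q q `|` U') `|g z|%:E))); last first.
  rewrite lee_pmul2l ?lte_fin ?exprn_gt0//.
  by apply: ge0_le_integral_nomeas => // x [/QU|/U'U].
rewrite ge0_integral_setU//; last 3 first.
- exact: measurable_cube.
- exact: mQ.
- rewrite disj_set2E; apply/eqP/seteqP; split => // x [qx [p /= ps' px]].
  move: ps'; rewrite mem_filter => /andP[/asboolP pq _].
  by have : (Q p `&` Q q) x by []; rewrite pq.
rewrite ge0_muleDr ?integral_ge0//; apply: leeD => //.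
rewrite vol_cube ?mulr_ge0 ?(ltW q0)// exprMn -EFinM mulrCA EFinM.
by rewrite lee_pmul2l ?lte_fin ?exprn_gt0.
Qed.

(** The Vitali bound for finite families passes to the countable union of rational cubes by
    continuity of the measure from below; [F k] collects the cubes with code below [k]. *)
Lemma weak_type g (y : R) : measurable_fun setT g -> (0 < y)%R ->
  y%:E * mu [set x | y%:E < maximal g x] <=
  (3 ^+ n)%:E * \int[mu]_z `|g z|%:E.
Proof.
move=> mg y0; rewrite gt_maximal_ratcube.
set P := [set p | _].
pose rs k := pmap (@unpickle ('rV[rat]_n * rat)%type) (iota 0 k).
pose F k : set E := \bigcup_(p in [set p | P p /\ p \in rs k]) ratcube R p.
pose rc (p : 'rV[rat]_n * rat) : 'rV[R]_n * R :=
  ((\row_i ratr (p.1 ord0 i))%R, ratr p.2).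
pose ss k : seq ('rV[R]_n * R) := [seq rc p | p <- rs k & `[< P p >]].
have FE k : F k = \bigcup_(p in [set` ss k]) Q p.
  apply/seteqP; split=> x.
    move=> [p [/= Pp pk] px]; exists (rc p) => //=.
    by apply/mapP; exists p => //; rewrite mem_filter asboolT.
  move=> [q /= /mapP[p]]; rewrite mem_filter => /andP[/asboolP Pp pk] -> Qx.
  by exists p.
have rsS p k : p \in rs k <-> exists2 i, (i < k)%N & unpickle i = Some p.
  rewrite mem_pmap; split=> [/mapP[i]|[i ik ip]].
    by rewrite mem_iota/= add0n => ik ip; exists i.
  by apply/mapP; exists i; rewrite ?mem_iota.
have -> : \bigcup_(p in P) ratcube R p = \bigcup_k F k.
  apply/seteqP; split=> x.
    move=> [p Pp px]; exists (pickle p).+1 => //; exists p => //=; split => //.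
    by apply/rsS; exists (pickle p); rewrite ?pickleK.
  by move=> [k _ [p [Pp _] px]]; exists p.
have mF k : measurable (F k) by rewrite FE; exact: mQ.
have cF : mu \o F @ \oo --> mu (\bigcup_k F k).
  apply: nondecreasing_cvg_mu => //; first exact: bigcupT_measurable.
  move=> i j ij; apply/subsetPset => x [p [Pp pi] px].
  exists p => //; split => //=; move/rsS : pi => [l li lp]; apply/rsS; exists l => //.
  exact: leq_trans ij.
rewrite muleC -lee_pdivlMr//.
rewrite -(cvg_lim _ cF)//; apply: lime_le; first by apply/cvg_ex; exists (mu (\bigcup_k F k)).
apply: nearW => k /=.
rewrite lee_pdivlMr// muleC FE.
apply: le_trans (vitali_weak_type mg (ltW y0) _) _; last first.
  rewrite lee_pmul2l ?lte_fin ?exprn_gt0//.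
  by apply: ge0_le_integral_nomeas.
move=> q /mapP[p]; rewrite mem_filter => /andP[/asboolP[p0 pP] _] ->/=.
by rewrite ltr0q; split => //; exact: ltW.
Qed.
End weak_type.

(** * Level sets of iterated maximal functions *)

Lemma nneseries_le (R : realType) (f : nat -> \bar R) (M : \bar R) :
  (forall j, 0 <= f j) -> (forall N, \sum_(0 <= j < N) f j <= M) ->
  \sum_(j <oo) f j <= M.
Proof.
move=> f0 fM; apply: lime_le; first exact: is_cvg_nneseries.
exact: nearW.
Qed.

Lemma geometric_half_le (R : realType) (z : R) (J : nat) :
  (0 <= z <= 2^-1)%R -> (\sum_(0 <= i < J) z ^+ i <= 2)%R.
Proof.
move=> /andP[z0 z2].
(* Subtracting the remainder makes the bound inductive: [z ^+ J.+1] is at most half of [z ^+ J]. *)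
suff : (\sum_(0 <= i < J) z ^+ i <= 2 - 2 * z ^+ J)%R.
  by move/le_trans; apply; rewrite gerBl mulr_ge0// exprn_ge0.
elim: J => [|J IH]; first by rewrite big_nil expr0; lra.
rewrite big_nat_recr//= (le_trans (lerD IH (lexx _)))// exprS.
have := exprn_ge0 J z0; nra.
Qed.

(* Summation by parts against [1 - q]. *)
Lemma sum_exchange_le (R : realType) (q : R) (a : nat -> R) (J : nat) :
  (2^-1 <= q < 1)%R -> (forall l, 0 <= a l)%R ->
  ((1 - q) * \sum_(0 <= i < J) (q ^+ i * \sum_(0 <= l < i.+2) a l) <=
   2 * \sum_(0 <= l < J.+1) q ^+ l * a l)%R.
Proof.
move=> /andP[q2 q1] a0.
(* The boundary term of the summation by parts is kept, which closes the induction; the factor 2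
   pays for [q ^+ J <= 2 * q ^+ J.+1]. *)
suff : ((1 - q) * \sum_(0 <= i < J) (q ^+ i * \sum_(0 <= l < i.+2) a l) +
   q ^+ J * \sum_(0 <= l < J.+1) a l <=
   2 * \sum_(0 <= l < J.+1) q ^+ l * a l)%R.
  apply: le_trans; rewrite lerDl mulr_ge0 ?exprn_ge0 ?sumr_ge0//; lra.
elim: J => [|J IH].
  by rewrite big_nil !big_nat1 expr0 !mul1r mulr0 add0r; have := a0 0%N; lra.
rewrite big_nat_recr//= [X in (_ <= 2 * X)%R]big_nat_recr//=.
have -> : (\sum_(0 <= l < J.+2) a l = \sum_(0 <= l < J.+1) a l + a J.+1)%R.
  by rewrite big_nat_recr.
move: IH; set s1 := (\sum_(0 <= i < J) _)%R; set A := (\sum_(0 <= l < J.+1) a l)%R.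
set s2 := (\sum_(0 <= l < J.+1) _)%R => IH.
have qJ : (0 <= q ^+ J * a J.+1)%R by rewrite mulr_ge0 ?exprn_ge0//; lra.
have : (q ^+ J * a J.+1 <= 2 * (q ^+ J.+1 * a J.+1))%R.
  by rewrite exprS -mulrA; nra.
rewrite !exprS; move: (q ^+ J)%R => z in IH *; move: IH; set b := a J.+1.
move=> IH H; nra.
Qed.

(** The index l with 2^-(l+1) < v <= 2^-l alone contributes 2^-l, which is at least [v]; if v >
    2^-L, then l < L. *)
Lemma dyadic_le (R : realType) (v : R) (L : nat) : (0 <= v <= 1)%R ->
  (v * (2^-1 ^+ L < v)%R%:R <=
   \sum_(0 <= l < L) 2^-1 ^+ l * (2^-1 ^+ l.+1 < v)%R%:R)%R.
Proof.
move=> /andP[v0 v1]; elim: L => [|L IH].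
  by rewrite big_nil expr0 ltNge v1/= mulr0.
have S0 : (0 <= \sum_(0 <= l < L) 2^-1 ^+ l * (2^-1 ^+ l.+1 < v)%R%:R :> R)%R.
  by rewrite sumr_ge0// => l _; rewrite mulr_ge0// exprn_ge0.
rewrite big_nat_recr//=; case: (ltP (2^-1 ^+ L.+1)%R v) => [h|_]; last first.
  by rewrite !mulr0 addr0.
rewrite !mulr1; case: (ltP (2^-1 ^+ L)%R v) IH => [_|h']; rewrite ?mulr1.
  by move=> IH; rewrite (le_trans IH)// lerDl exprn_ge0.
by move=> _; rewrite (le_trans h')// lerDr.
Qed.

Section level_sets.
Variables (R : realType) (n : nat).
Local Notation E := (Rn R n).
Local Notation mu := (vol R n).
Implicit Types (g h : E -> R) (x : E).

Definition unit_fun g := measurable_fun setT g /\ forall x, (0 <= g x <= 1)%R.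

(** Heights start at 1/2, since a [unit_fun] never exceeds 1. With this shift the band 2^-(l+1) < g
    <= 2^-l lies in [lev g l]. *)
Definition lev g (l : nat) : set E := [set x | 2^-1 ^+ l.+1 < g x]%R.

Lemma measurable_lev g l : unit_fun g -> measurable (lev g l).
Proof.
move=> [mg _]; rewrite -[lev g l]setTI.
rewrite (_ : lev g l = g @^-1` `]2^-1 ^+ l.+1, +oo[%classic%R); last first.
  by apply/seteqP; split=> x; rewrite /lev/= in_itv/= andbT.
by apply: mg => //; exact: measurable_itv.
Qed.

Lemma integral_lev g (D : set E) (L : nat) : unit_fun g -> measurable D ->
  \int[mu]_(x in D) (g x * (2^-1 ^+ L < g x)%R%:R)%:E <=
  \sum_(0 <= l < L) (2^-1 ^+ l)%:E * mu (lev g l).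
Proof.
move=> ug mD; have [mg g01] := ug.
apply: (@le_trans _ _ (\int[mu]_(x in D)
   \sum_(0 <= l < L) (2^-1 ^+ l)%:E * (\1_(lev g l) x)%:E)).
  apply: ge0_le_integral_nomeas => // x Dx.
  - by apply: sume_ge0 => l _; rewrite -EFinM lee_fin mulr_ge0 ?exprn_ge0.
  - by rewrite lee_fin mulr_ge0//; have /andP[] := g01 x.
  - have := dyadic_le L (g01 x); rewrite -lee_fin => /le_trans; apply.
    rewrite -sumEFin le_eqVlt; apply/orP; left; apply/eqP; apply: eq_bigr => l _.
    by rewrite -EFinM indicE /lev mem_setE.
have m1 l : measurable_fun D (fun x => (\1_(lev g l) x : R)%:E).
  by apply/measurable_EFinP/measurable_indic; exact: measurable_lev.
rewrite ge0_integral_sum//; last by move=> l; exact: measurable_funeM.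
apply: lee_sum => l _; rewrite ge0_integralZl_EFin//.
rewrite lee_wpmul2l ?lee_fin ?exprn_ge0// integral_indic//; last exact: measurable_lev.
by apply: le_measure; rewrite ?inE//; [apply: measurableI => //|]; exact: measurable_lev.
Qed.

Lemma integral_cube_cst (a : 'rV[R]_n) (l r : R) : (0 <= l)%R ->
  \int[mu]_(x in cube a l) cst r%:E x = (r * l ^+ n)%:E.
Proof.
move=> l0; have mQ : measurable (cube a l : set E) by exact: measurable_cube.
rewrite EFinM -(vol_cube a l0); exact: (integral_cst mu mQ r%:E).
Qed.

Lemma maximal_le1 g x : unit_fun g -> maximal g x <= 1%:E.
Proof.
move=> [mg g01]; apply: ge_ereal_sup => _ [Q [a [l [l0 -> Qx]]] <-].
rewrite vol_cube ?(ltW l0)//= lee_pdivrMl ?exprn_gt0// mule1.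
apply: (@le_trans _ _ (\int[mu]_(y in cube a l) cst 1%:E y)).
  apply: ge0_le_integral_nomeas => // y _; rewrite ?lee_fin//.
  by have /andP[g0 g1] := g01 y; rewrite ger0_norm.
by rewrite integral_cube_cst ?(ltW l0)// mul1r.
Qed.

(** Real-valued, so that M can be iterated; [fine] loses nothing on a [unit_fun], where M g <= 1. *)
Definition fmax g x : R := fine (maximal g x).

Lemma fmaxE g x : unit_fun g -> (fmax g x)%:E = maximal g x.
Proof.
move=> ug; rewrite fineK// ge0_fin_numE ?maximal_ge0//.
by rewrite (le_lt_trans (maximal_le1 x ug))// ltry.
Qed.

Lemma unit_fmax g : unit_fun g -> unit_fun (fmax g).
Proof.
move=> ug; split; last first.
  by move=> x; rewrite -!lee_fin fmaxE// maximal_ge0 maximal_le1.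
apply/measurable_EFinP; rewrite (_ : _ \o _ = maximal g).
  exact: measurable_maximal.
by apply/funext => x /=; rewrite fmaxE.
Qed.

Lemma cube_integral_le g a l x : unit_fun g -> (0 < l)%R -> cube a l x ->
  \int[mu]_(z in cube a l) (g z)%:E <= (fmax g x * l ^+ n)%:E.
Proof.
move=> ug l0 Qx; rewrite leNgt; apply/negP => H.
suff : (fmax g x)%:E < maximal g x by rewrite fmaxE// ltxx.
apply/lt_maximalP; exists a, l; split => //.
apply: (lt_le_trans H); apply: ge0_le_integral_nomeas => // z _.
  by rewrite lee_fin; have /andP[] := ug.2 z.
by rewrite lee_fin ler_norm.
Qed.

(** Values of [g] up to [eta], half of the level 2^-(i+1), add at most [eta] to an average, so the
    part [h] of [g] above [eta] must itself have average above [eta]. The weak type inequality is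
    applied to [h], whose integral sees only the levels of index below [i.+2]. *)
Lemma weak_type_lev g i : unit_fun g ->
  mu (lev (fmax g) i) <= (3 ^+ n * 2 ^+ i.+2)%:E *
    \sum_(0 <= l < i.+2) (2^-1 ^+ l)%:E * mu (lev g l).
Proof.
move=> ug; have [mg g01] := ug.
pose eta : R := (2^-1 ^+ i.+2)%R.
have eta0 : (0 < eta)%R by rewrite exprn_gt0.
pose h x := (g x * (eta < g x)%R%:R)%R.
have h0 x : (0 <= h x)%R by rewrite mulr_ge0//; have /andP[] := g01 x.
have mh : measurable_fun setT h.
  rewrite (_ : h = g \* \1_(lev g i.+1))%R; last first.
    by apply/funext => x; rewrite /h/= indicE /lev mem_setE.
  apply: measurable_funM => //; apply: measurable_indic; exact: measurable_lev.
have sub : lev (fmax g) i `<=` [set x | eta%:E < maximal h x].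
  move=> x; rewrite /lev/= -lte_fin fmaxE// => /lt_maximalP[a [l [l0 Qx H]]].
  apply/lt_maximalP; exists a, l; split => //.
  have mQ : measurable (cube a l : set E) by exact: measurable_cube.
  have : \int[mu]_(z in cube a l) `|g z|%:E <=
     \int[mu]_(z in cube a l) `|h z|%:E + (eta * l ^+ n)%:E.
    apply: (@le_trans _ _ (\int[mu]_(z in cube a l) (`|h z|%:E + cst eta%:E z))).
      apply: ge0_le_integral_nomeas => // z _ /=; rewrite -?EFinD lee_fin ?addr_ge0 ?(ltW eta0)//.
      rewrite /h; have /andP[g0 g1] := g01 z.
      by rewrite !ger0_norm ?mulr_ge0//; case: (ltP eta) => /= ?; rewrite ?mulr1 ?mulr0; lra.
    rewrite ge0_integralD//=; last 2 first.
    - by apply/measurable_EFinP; apply: measurableT_comp => //; exact: measurable_funTS.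
    - by move=> z _; rewrite lee_fin (ltW eta0).
    by rewrite leeD2l// integral_cube_cst ?(ltW l0).
  move=> /(lt_le_trans H); rewrite -lteBlDr// -EFinB.
  suff -> : (2^-1 ^+ i.+1 * l ^+ n - eta * l ^+ n = eta * l ^+ n)%R by [].
  have -> : (2^-1 ^+ i.+1 = 2 * eta :> R)%R by rewrite /eta [in RHS]exprS; field.
  by ring.
have m1 : measurable (lev (fmax g) i) by apply: measurable_lev; exact: unit_fmax.
have mm : measurable [set x | eta%:E < maximal h x].
  rewrite -[X in measurable X]setTI; apply: emeasurable_fun_o_infty => //.
  exact: measurable_maximal.
have : mu (lev (fmax g) i) <= mu [set x | eta%:E < maximal h x].
  by apply: le_measure; rewrite ?inE.
move=> /le_trans; apply.
have := weak_type mh eta0; rewrite -lee_pdivlMl// => /le_trans; apply.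
rewrite (_ : eta^-1 = 2 ^+ i.+2)%R; last by rewrite /eta exprVn invrK.
rewrite muleA -EFinM mulrC; apply: lee_wpmul2l.
  by rewrite lee_fin mulr_ge0 ?exprn_ge0.
apply: le_trans (integral_lev i.+2 ug measurableT).
by apply: ge0_le_integral_nomeas => // z _; rewrite lee_fin; [exact: h0|rewrite ger0_norm].
Qed.

End level_sets.

(** * A discrete L^p bound and its behaviour under M *)

Section level_bound.
Variables (R : realType) (n : nat).
Local Notation E := (Rn R n).
Local Notation mu := (vol R n).
Implicit Types (g h : E -> R) (x : E).

(* A discrete form of the bound [\int g^p <= X], where [q = 2^(1 - p)]. *)
Definition level_bound (q X : R) g := forall J : nat,
  \sum_(0 <= i < J) ((q / 2) ^+ i)%:E * mu (lev g i) <= X%:E.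

Lemma level_bound_fin_num q X g l : (0 < q)%R -> level_bound q X g ->
  mu (lev g l) \is a fin_num.
Proof.
move=> q0 /(_ l.+1) H; rewrite ge0_fin_numE//.
have ql : (0 < (q / 2) ^+ l)%R by rewrite exprn_gt0// divr_gt0.
have : ((q / 2) ^+ l)%:E * mu (lev g l) <= X%:E.
  apply: le_trans H; rewrite big_nat_recr//= leeDr// sume_ge0// => i _.
  by rewrite mule_ge0// lee_fin exprn_ge0// divr_ge0// ltW.
by rewrite -lee_pdivlMl// => /le_lt_trans; apply; rewrite ltry.
Qed.

(** Discrete form of the boundedness of M on L^p, with its blow-up as p tends to 1. After
    [weak_type_lev] and an interchange of sums, the geometric series in q gives 1/(1 - q); the 8 is
    the 4 in [2 ^+ i.+2] times the 2 of [sum_exchange_le]. *)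
Lemma level_bound_fmax q X g : (2^-1 <= q < 1)%R -> unit_fun g ->
  level_bound q X g -> level_bound q (8 * 3 ^+ n * (1 - q)^-1 * X) (fmax g).
Proof.
move=> q01 ug H J; have /andP[q2 q1] := q01.
have q0 : (0 < q)%R by lra.
pose m l := fine (mu (lev g l)).
have mE l : mu (lev g l) = (m l)%:E.
  by rewrite /m fineK// (level_bound_fin_num _ q0 H).
have m0 l : (0 <= m l)%R by rewrite fine_ge0.
apply: (@le_trans _ _ (\sum_(0 <= i < J) ((q / 2) ^+ i * (3 ^+ n * 2 ^+ i.+2 *
    \sum_(0 <= l < i.+2) (2^-1 ^+ l * m l)))%R%:E)).
  apply: lee_sum => i _; rewrite [leRHS]EFinM; apply: lee_wpmul2l.
    by rewrite lee_fin exprn_ge0// divr_ge0// ltW.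
  apply: le_trans (weak_type_lev i ug) _; rewrite [leRHS]EFinM; apply: lee_wpmul2l.
    by rewrite lee_fin mulr_ge0 ?exprn_ge0.
  rewrite -sumEFin le_eqVlt; apply/orP; left; apply/eqP; apply: eq_bigr => l _.
  by rewrite mE.
rewrite sumEFin lee_fin.
have a0 l : (0 <= 2^-1 ^+ l * m l)%R by rewrite mulr_ge0// exprn_ge0.
have := sum_exchange_le J q01 a0.
have -> : (\sum_(0 <= i < J) (q / 2) ^+ i * (3 ^+ n * 2 ^+ i.+2 *
    \sum_(0 <= l < i.+2) 2^-1 ^+ l * m l) = 4 * 3 ^+ n *
    \sum_(0 <= i < J) (q ^+ i * \sum_(0 <= l < i.+2) 2^-1 ^+ l * m l))%R.
  rewrite mulr_sumr; apply: eq_bigr => i _.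
  have -> : (q ^+ i = (q / 2) ^+ i * 2 ^+ i)%R by rewrite -exprMn divfK.
  by rewrite !exprS; ring.
have : (\sum_(0 <= l < J.+1) q ^+ l * (2^-1 ^+ l * m l) <= X)%R.
  have := H J.+1; rewrite -lee_fin -sumEFin => H'; apply: le_trans H'.
  rewrite le_eqVlt; apply/orP; left; apply/eqP; apply: eq_bigr => l _.
  by rewrite mE -EFinM mulrA exprMn.
set s := (\sum_(0 <= l < J.+1) _)%R; set s' := (\sum_(0 <= l < J) _)%R => sX.
have q1' : (0 < 1 - q)%R by lra.
have n3 : (0 <= 3 ^+ n :> R)%R by rewrite exprn_ge0.
rewrite mulrC -ler_pdivlMr// => H1; apply: (@le_trans _ _ (4 * 3 ^+ n * (2 * X / (1 - q)))%R).
  rewrite ler_wpM2l ?mulr_ge0//; apply: (le_trans H1).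
  by rewrite ler_wpM2r ?invr_ge0 ?(ltW q1')// ler_wpM2l.
by rewrite le_eqVlt; apply/orP; left; apply/eqP; ring.
Qed.

Lemma unit_indic (F : set E) : measurable F -> unit_fun (\1_F).
Proof.
by move=> mF; split; [exact: measurable_indic|move=> x; rewrite indicE; case: (_ \in _); rewrite lexx ler01].
Qed.

Lemma level_bound_indic q t (F : set E) : (0 <= q <= 1)%R -> measurable F ->
  mu F = t%:E -> level_bound q (2 * t) (\1_F).
Proof.
move=> /andP[q0 q1] mF Ft J.
have t0 : (0 <= t)%R by rewrite -lee_fin -Ft.
apply: (@le_trans _ _ (\sum_(0 <= i < J) ((q / 2) ^+ i * t)%R%:E)).
  apply: lee_sum => i _; rewrite [leRHS]EFinM; apply: lee_wpmul2l; first by rewrite lee_fin exprn_ge0 ?divr_ge0.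
  rewrite -Ft; apply: le_measure; rewrite ?inE//.
    by apply: measurable_lev; exact: unit_indic.
  move=> x; rewrite /lev/= indicE; case: (boolP (x \in F)) => [/set_mem//|_].
  by rewrite ltNge exprn_ge0.
rewrite sumEFin lee_fin -mulr_suml ler_wpM2r// geometric_half_le//.
by apply/andP; split; lra.
Qed.

(** Plays the part of Hölder's inequality. Where g <= 2^-L, the set [A] contributes at most [t];
    above that height only levels l < L occur, and 2^-l <= 2 (q/2)^l because q^l >= q^L >= 1/2. *)
Lemma integral_level_bound q X t g (A : set E) (L : nat) : unit_fun g ->
  (0 < q <= 1)%R -> (2^-1 <= q ^+ L)%R -> measurable A ->
  mu A <= (2 ^+ L * t)%:E -> level_bound q X g ->
  \int[mu]_(x in A) (g x)%:E <= (t + 2 * X)%:E.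
Proof.
move=> ug /andP[q0 q1] qL mA At H; have [mg g01] := ug.
pose k : R := (2^-1 ^+ L)%R.
have k0 : (0 < k)%R by rewrite exprn_gt0.
have gk0 x : (0 <= g x * (k < g x)%R%:R)%R by rewrite mulr_ge0//; case/andP: (g01 x).
apply: (@le_trans _ _ (\int[mu]_(x in A) ((g x * (k < g x)%R%:R)%:E + cst k%:E x))).
  apply: ge0_le_integral_nomeas => // x _ /=; rewrite -?EFinD lee_fin.
  - by rewrite addr_ge0// (ltW k0).
  - by case/andP: (g01 x).
  - by have /andP[g0 g1] := g01 x; case: (ltP k) => /= ?; rewrite ?mulr1 ?mulr0; lra.
rewrite ge0_integralD//=; last 3 first.
- by move=> x _; rewrite lee_fin.
- apply/measurable_EFinP; apply: (@measurable_funS _ _ _ _ setT) => //.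
  have -> : (fun x => g x * (k < g x)%R%:R)%R = (g \* \1_[set x | (k < g x)%R])%R.
    by apply/funext => x /=; rewrite indicE mem_setE.
  apply: measurable_funM => //; apply: measurable_indic.
  rewrite -[X in measurable X]setTI (_ : [set x | (k < g x)%R] = g @^-1` `]k, +oo[%classic%R).
    by apply: mg => //; exact: measurable_itv.
  by apply/seteqP; split=> x /=; rewrite in_itv/= andbT.
- by move=> x _; rewrite lee_fin (ltW k0).
rewrite addeC EFinD; apply: leeD.
  rewrite integral_cst//; apply: (@le_trans _ _ (k%:E * (2 ^+ L * t)%:E)).
    by apply: lee_wpmul2l; rewrite ?lee_fin ?(ltW k0).
  by rewrite -EFinM lee_fin mulrA -exprMn mulVf// expr1n mul1r.
apply: le_trans (integral_lev L ug mA) _.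
apply: (@le_trans _ _ (2%:E * \sum_(0 <= l < L) ((q / 2) ^+ l)%:E * mu (lev g l))); last first.
  by rewrite [leRHS]EFinM; apply: lee_wpmul2l; rewrite ?lee_fin.
rewrite ge0_sume_distrr; last first.
  by move=> i _; rewrite mule_ge0// lee_fin exprn_ge0// divr_ge0// ltW.
rewrite [leLHS]big_nat [leRHS]big_nat; apply: lee_sum => l /= lL.
rewrite muleA -EFinM; apply: lee_wpmul2r => //; rewrite lee_fin exprMn mulrA ler_peMl ?exprn_ge0//.
have : (q ^+ L <= q ^+ l)%R by rewrite ler_wiXn2l ?(ltW q0)// ltnW.
by move: qL; lra.
Qed.
End level_bound.

(** * Rubio de Francia weights *)

Section rubio_de_francia.
Variables (R : realType) (n : nat).
Local Notation E := (Rn R n).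
Local Notation mu := (vol R n).

Lemma compact_sub_cube (K : set 'rV[R]_n) : compact K ->
  exists (a : 'rV[R]_n) (l : R), (0 < l)%R /\ (K : set E) `<=` cube a l.
Proof.
move=> /compact_bounded[M [Mr KM]].
pose r : R := (`|M| + 1)%R.
have Mr1 : (M < r)%R by rewrite /r (le_lt_trans (ler_norm M))// ltrDl.
have r0 : (0 < r)%R by rewrite /r ltr_wpDl.
exists (const_mx (- r))%R, (2 * r)%R; split; first by rewrite mulr_gt0.
move=> x Kx i; rewrite mxE.
have xr : (`|x : 'rV[R]_n| <= r)%R := KM _ Mr1 _ Kx.
have : (`|(x : 'rV[R]_n) ord0 i| <= r)%R.
  apply: le_trans xr; rewrite [leRHS]/Num.norm/= mx_normrE.
  exact: (le_bigmax _ (fun ij => `|(x : 'rV[R]_n) ij.1 ij.2|)%R (ord0, i)).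
by rewrite ler_norml => /andP[h1 h2]; apply/andP; split; lra.
Qed.

Lemma bounded_weight (u : E -> R) (M : R) : measurable_fun setT u ->
  (forall x, 0 <= u x <= M)%R -> weight u.
Proof.
move=> mu' u01; split => // [x|K cK]; first by have /andP[] := u01 x.
have [a [l [l0 Kal]]] := compact_sub_cube cK.
apply: (@le_lt_trans _ _ (\int[mu]_(x in cube a l) cst M%:E x)).
  apply: ge0_le_integral_nomeas => // x _; rewrite lee_fin; have /andP[h1 h2] := u01 x.
    exact: le_trans h2.
  by rewrite ger0_norm.
by rewrite integral_cube_cst ?(ltW l0)// ltry.
Qed.

Section construction.
Variables (F : set E) (B : R).
Hypotheses (mF : measurable F) (B2 : (2 <= B)%R).

Let g (j : nat) : E -> R := iter j (@fmax R n) (\1_F).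

Let ug j : unit_fun (g j).
Proof. by elim: j => [|j IH] /=; [exact: unit_indic|exact: unit_fmax]. Qed.

Let Bp : (0 < B)%R. Proof. by move: B2; lra. Qed.

Let B0 : (0 < B^-1)%R. Proof. by rewrite invr_gt0. Qed.

Let Bhalf : (0 <= B^-1 <= 2^-1)%R.
Proof. by rewrite (ltW B0)/= lef_pV2 ?posrE. Qed.

Let U x : \bar R := \sum_(j <oo) (B^-1 ^+ j * g j x)%:E.

Let term_ge0 j x : 0 <= (B^-1 ^+ j * g j x)%:E.
Proof.
by rewrite lee_fin mulr_ge0 ?exprn_ge0 ?(ltW B0)//; have /andP[] := (ug j).2 x.
Qed.

(** The iterates are at most 1 and 1/B is at most 1/2, so the sum is at most 2 and [fine] discards
    nothing. *)
Definition rdf x : R := fine (U x).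

Let U_le2 x : U x <= 2%:E.
Proof.
apply: nneseries_le => // N.
apply: (@le_trans _ _ (\sum_(0 <= j < N) (B^-1 ^+ j)%:E)).
  apply: lee_sum => j _; rewrite lee_fin ler_piMr ?exprn_ge0 ?(ltW B0)//.
  by have /andP[] := (ug j).2 x.
by rewrite sumEFin lee_fin geometric_half_le.
Qed.

Let U_ge0 x : 0 <= U x. Proof. exact: nneseries_ge0. Qed.

Lemma rdfE x : (rdf x)%:E = U x.
Proof.
by rewrite fineK// ge0_fin_numE// (le_lt_trans (U_le2 x))// ltry.
Qed.

Lemma rdf_ge0 x : (0 <= rdf x <= 2)%R.
Proof. by rewrite -!lee_fin rdfE U_ge0 U_le2. Qed.

Let mterm (D : set E) j : measurable_fun D (fun x => (B^-1 ^+ j * g j x)%:E).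
Proof.
apply/measurable_EFinP; apply: measurable_funM => //.
by apply: (@measurable_funS _ _ _ _ setT) => //; exact: (ug j).1.
Qed.

Lemma measurable_rdf : measurable_fun setT rdf.
Proof.
apply/measurable_EFinP; rewrite (_ : _ \o _ = U); last first.
  by apply/funext => x; rewrite /= rdfE.
exact: ge0_emeasurable_sum.
Qed.

Lemma rdf_ge_indic x : F x -> (1 <= rdf x)%R.
Proof.
move=> Fx; rewrite -lee_fin rdfE.
apply: le_trans (nneseries_lim_ge 1 _); last by move=> *; exact: term_ge0.
by rewrite big_nat1 expr0 mul1r /g/= indicE mem_set.
Qed.

Lemma integral_rdf (A : set E) : measurable A ->
  \int[mu]_(x in A) (rdf x)%:E =
  \sum_(j <oo) (B^-1 ^+ j)%:E * \int[mu]_(x in A) (g j x)%:E.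
Proof.
move=> mA; under eq_integral do rewrite rdfE.
rewrite integral_nneseries//; apply: eq_eseriesr => j _.
under eq_integral do rewrite EFinM.
rewrite ge0_integralZl_EFin ?exprn_ge0 ?(ltW B0)//.
  by move=> x _; rewrite lee_fin; have /andP[] := (ug j).2 x.
apply/measurable_EFinP; apply: (@measurable_funS _ _ _ _ setT) => //.
exact: (ug j).1.
Qed.

(** M sends each iterate to the next, so averaging the sum over a cube shifts the series by one
    index; the missing power of 1/B is the factor B. The bound holds at every point. *)
Lemma maximal_rdf x : maximal rdf x <= (B * rdf x)%:E.
Proof.
rewrite leNgt; apply/negP => /lt_maximalP[a [l [l0 Qx]]]; apply/negP; rewrite -leNgt.
rewrite (eq_integral (fun z => (rdf z)%:E)); last first.
  by move=> z _; rewrite ger0_norm//; have /andP[] := rdf_ge0 z.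
rewrite integral_rdf; last exact: measurable_cube.
apply: nneseries_le => [j|N].
  rewrite mule_ge0// ?lee_fin ?exprn_ge0 ?(ltW B0)//.
  by apply: integral_ge0 => z _; rewrite lee_fin; have /andP[] := (ug j).2 z.
have ln0 : (0 < l ^+ n)%R by rewrite exprn_gt0.
apply: (@le_trans _ _ ((B * l ^+ n)%:E * \sum_(0 <= j < N.+1) (B^-1 ^+ j * g j x)%:E)).
  (* The shift: the nonnegative term of index 0 is split off, and the others match the integrals one
     by one. *)
  rewrite sumEFin -EFinM big_nat_recl//= mulrDr.
  apply: (@le_trans _ _ (\sum_(0 <= j < N) (B * l ^+ n * (B^-1 ^+ j.+1 * g j.+1 x))%R%:E)).
    apply: lee_sum => j _.
    apply: (@le_trans _ _ ((B^-1 ^+ j)%:E * (g j.+1 x * l ^+ n)%:E)).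
      apply: lee_wpmul2l; first by rewrite lee_fin exprn_ge0 ?(ltW B0).
      exact: cube_integral_le.
    rewrite -EFinM lee_fin le_eqVlt; apply/orP; left; apply/eqP.
    by rewrite exprS; field; move: Bp; lra.
  rewrite sumEFin lee_fin -mulr_sumr lerDr mulr_ge0 ?(ltW ln0)//.
    by rewrite mulr_ge0 ?(ltW ln0) ?(ltW Bp).
  by have := term_ge0 0 x; rewrite lee_fin.
rewrite (_ : B * rdf x * l ^+ n = B * l ^+ n * rdf x)%R; last by ring.
rewrite [leRHS]EFinM rdfE; apply: lee_wpmul2l.
  by rewrite lee_fin mulr_ge0 ?(ltW ln0) ?(ltW Bp).
by apply: nneseries_lim_ge => *; exact: term_ge0.
Qed.

End construction.
End rubio_de_francia.

(** * Properties of A_1 weights, and the weight attached to a set *)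

Section A1_weights.
Variables (R : realType) (n : nat).
Local Notation E := (Rn R n).
Local Notation mu := (vol R n).

Lemma ae_exists (P : E -> Prop) : {ae mu, forall x, P x} -> exists x, P x.
Proof.
move=> [N [mN N0 PN]]; apply: contrapT => noP.
have : mu (cube (0%R : 'rV[R]_n) 1 : set E) <= mu N.
  apply: le_measure; rewrite ?inE//; first exact: measurable_cube.
  by move=> x _; apply: PN => Px; apply: noP; exists x.
rewrite N0 (vol_cube _ ler01) expr1n.
by rewrite lee_fin ler10.
Qed.

(** If M w vanished at [x], so would the integral of |w| over every cube centred there; the cubes of
    side 2(k + 1) cover the space, and w would be zero almost everywhere. *)
Lemma maximal_gt0 (w : E -> R) x : measurable_fun setT w ->
  ~ {ae mu, forall x, w x = 0%R} -> 0 < maximal w x.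
Proof.
move=> mw w0; rewrite ltNge; apply/negP => Mx0; apply: w0.
pose a (k : nat) : 'rV[R]_n := (\row_i ((x : 'rV[R]_n) ord0 i - k.+1%:R))%R.
pose Q k : set E := cube (a k) (2 * k.+1%:R)%R.
have l0 k : (0 < 2 * k.+1%:R :> R)%R by rewrite mulr_gt0.
have Qx k : Q k x.
  by move=> i; rewrite mxE; have := ltr0Sn R k; move=> ?; apply/andP; split; lra.
have mQ k : measurable (Q k) by exact: measurable_cube.
have null k : mu.-negligible (Q k `&` [set z | w z <> 0%R]).
  have : \int[mu]_(z in Q k) `|(w z)%:E| = 0.
    apply/eqP; rewrite eq_le integral_ge0// andbT leNgt; apply/negP => I0.
    suff : 0 < maximal w x by rewrite ltNge Mx0.
    apply: (lt_maximalP w x 0%R).2; exists (a k), (2 * k.+1%:R)%R; split; [exact: l0|exact: Qx|].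
    by rewrite mul0r.
  have mwQ : measurable_fun (Q k) (fun z => (w z)%:E).
    by apply/measurable_EFinP; exact: (@measurable_funS _ _ _ _ setT).
  move=> /(ae_eq_integral_abs mu (mQ k) mwQ).1[N [mN N0 HN]].
  exists N; split => // z [Qz wz]; apply: HN => /=.
  by move=> /(_ Qz) [].
have [N [mN N0 HN]] : mu.-negligible (\bigcup_k (Q k `&` [set z | w z <> 0%R])).
  exact: negligible_bigcup.
exists N; split => // z /= wz; apply: HN.
pose r : R := (\sum_i `|(z : 'rV[R]_n) ord0 i - (x : 'rV[R]_n) ord0 i|)%R.
have [k rk] : exists k : nat, (r <= k.+1%:R)%R.
  by exists (Num.truncn r); rewrite ltW// truncnS_gt.
exists k => //; split => // i; rewrite mxE.
have : (`|(z : 'rV[R]_n) ord0 i - (x : 'rV[R]_n) ord0 i| <= k.+1%:R)%R.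
  apply: le_trans rk; rewrite /r (bigD1 i)//= lerDl.
  by rewrite sumr_ge0.
by rewrite ler_norml => /andP[h1 h2]; apply/andP; split; lra.
Qed.

(* [M w > y] on the whole of a cube over which [w] has average above [y]; so
   [M w <= c w] a.e. bounds [y] by [c] times an average of [w]. *)
Lemma A1_bound_ge1 (w : E -> R) c : A1 w -> A1_bound w c -> (1 <= c)%R.
Proof.
move=> [[mw w0 _] wn0 _] wc.
(* One point where the almost everywhere bound holds makes [maximal w x0] finite; its value is the
   [s] below. *)
have [x0 Mx0] := ae_exists wc.
have Mgt0 x : 0 < maximal w x by exact: maximal_gt0.
have c0 : (0 <= c)%R.
  rewrite leNgt; apply/negP => c0; have := lt_le_trans (Mgt0 x0) Mx0.
  by rewrite lte_fin ltNge mulr_le0_ge0// ltW.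
have [s Es] : exists s, maximal w x0 = s%:E.
  exists (fine (maximal w x0)); rewrite fineK// ge0_fin_numE ?maximal_ge0//.
  by rewrite (le_lt_trans Mx0)// ltry.
have s0 : (0 < s)%R by rewrite -lte_fin -Es.
(* A cube Q through [x0] over which w has average between s - e and s gives (s - e)|Q| <= c s
   |Q|. *)
rewrite -(ler_pM2r s0) mul1r; apply/ler_addgt0Pr => e e0.
have : (s - e)%:E < maximal w x0 by rewrite Es lte_fin ltrBlDr ltrDl.
move=> /lt_maximalP[a [l [l0 Qx yQ]]].
have ln0 : (0 < l ^+ n)%R by rewrite exprn_gt0.
have mQ : measurable (cube a l : set E) by exact: measurable_cube.
have absw (D : set E) : \int[mu]_(z in D) `|w z|%:E = \int[mu]_(z in D) (w z)%:E.
  by apply: eq_integral => z _; rewrite ger0_norm.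
have MQ z : cube a l z -> (s - e)%:E <= maximal w z.
  by move=> Qz; apply/ltW/lt_maximalP; exists a, l.
have H1 : ((s - e) * l ^+ n)%:E <= \int[mu]_(z in cube a l) maximal w z.
  rewrite -(integral_cube_cst a _ (ltW l0)).
  have [se0|se0] := leP 0%R (s - e)%R.
    by apply: ge0_le_integral_nomeas => // z Qz; first [exact: maximal_ge0|exact: MQ].
  rewrite integral_cube_cst ?(ltW l0)//; apply: (@le_trans _ _ 0).
    by rewrite lee_fin mulr_le0_ge0// ltW.
  by apply: integral_ge0 => z _; exact: maximal_ge0.
have H2 : \int[mu]_(z in cube a l) maximal w z <= \int[mu]_(z in cube a l) (c%:E * (w z)%:E).
  apply: ae_ge0_le_integral => //.
  - by move=> z _; exact: maximal_ge0.
  - by apply: (@measurable_funS _ _ _ _ setT) => //; exact: measurable_maximal.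
  - by move=> z _; rewrite -EFinM lee_fin mulr_ge0.
  - apply: measurable_funeM; apply/measurable_EFinP.
    exact: (@measurable_funS _ _ _ _ setT).
  - by apply: filterS wc => z; rewrite EFinM.
have H3 : \int[mu]_(z in cube a l) (w z)%:E <= (s * l ^+ n)%:E.
  rewrite leNgt; apply/negP => H; suff : s%:E < maximal w x0 by rewrite Es ltxx.
  by apply/lt_maximalP; exists a, l; rewrite absw.
move: (le_trans H1 H2); rewrite ge0_integralZl_EFin//; last 2 first.
- by move=> z _; rewrite lee_fin.
- by apply/measurable_EFinP; exact: (@measurable_funS _ _ _ _ setT).
move=> H4; have : ((s - e) * l ^+ n)%:E <= c%:E * (s * l ^+ n)%:E.
  by apply: (le_trans H4); apply: lee_wpmul2l; rewrite ?lee_fin.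
by rewrite -EFinM lee_fin mulrA ler_pM2r// lerBlDr.
Qed.

Lemma A1_norm_ge1 (w : E -> R) : A1 w -> 1 <= A1_norm w.
Proof.
move=> Aw; apply: le_ereal_inf_tmp => _ [c /= wc <-].
by rewrite lee_fin; exact: A1_bound_ge1 wc.
Qed.

Lemma A1_norm_le (w : E -> R) c : A1_bound w c -> A1_norm w <= c%:E.
Proof. by move=> wc; apply: ereal_inf_lbound; exists c. Qed.

Lemma A1_gt0 (w : E -> R) : A1 w -> {ae mu, forall x, (0 < w x)%R}.
Proof.
move=> Aw; have [[mw w0 _] wn0 [c wc]] := Aw.
have c1 := A1_bound_ge1 Aw wc.
apply: filterS wc => x; move/(lt_le_trans (maximal_gt0 x mw wn0)).
by rewrite lte_fin pmulr_rgt0//; lra.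
Qed.

Lemma exists_A1_weight (F : set E) (L : nat) : measurable F ->
  0 < mu F -> mu F < +oo -> (0 < L)%N ->
  exists u : E -> R, [/\ A1 u, A1_norm u <= (32 * 3 ^+ n * L%:R)%:E,
    forall x, (0 <= u x <= 2)%R, forall x, F x -> (1 <= u x)%R &
    forall A : set E, measurable A -> mu A <= (2 ^+ L)%:E * mu F ->
      \int[mu]_(x in A) (u x)%:E <= 10%:E * mu F].
Proof.
move=> mF F0 Foo L0.
(* This is 8 * 3^n / (1 - q) for the [q] chosen below: the factor by which one application of M
   enlarges a level bound. *)
pose kappa : R := (16 * 3 ^+ n * L%:R)%R.
have L1 : (1 <= L%:R :> R)%R by rewrite ler1n.
have n3 : (1 <= 3 ^+ n :> R)%R by rewrite exprn_ege1// ler1n.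
have kappa1 : (1 <= kappa)%R by rewrite /kappa; nra.
(* Twice [kappa], so that the level bounds of the iterates, weighted by powers of 1/B, decay like
   2^-j. *)
pose B : R := (2 * kappa)%R.
have B2 : (2 <= B)%R by rewrite /B; lra.
have Bk : (B^-1 * kappa = 2^-1)%R by rewrite /B invfM mulfVK// gt_eqF//; lra.
have Bkj j : (2^-1 ^+ j = B^-1 ^+ j * kappa ^+ j)%R by rewrite -Bk -exprMn.
have [t Ft] : exists t, mu F = t%:E.
  by exists (fine (mu F)); rewrite fineK// ge0_fin_numE.
have t0 : (0 < t)%R by rewrite -lte_fin -Ft.
pose u := rdf F B.
have Au : A1_bound u B by apply: aeW => x; exact: maximal_rdf.
exists u; split.
- split; last by exists B.
    by apply: bounded_weight (rdf_ge0 mF B2); exact: measurable_rdf.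
  move=> [N [mN N0 HN]]; suff : mu F <= 0 by rewrite leNgt F0.
  rewrite -N0; apply: le_measure; rewrite ?inE// => x Fx; apply: HN => /= ux.
  by have := rdf_ge_indic mF B2 Fx; rewrite -/u ux ler10.
- by apply: (le_trans (A1_norm_le Au)); rewrite lee_fin /B /kappa; lra.
- exact: rdf_ge0.
- by move=> x; exact: rdf_ge_indic.
move=> A mA AF.
(* Here 1/(1 - q) = 2L, and Bernoulli's inequality gives q^L >= 1 - L/(2L) = 1/2. *)
pose q : R := (1 - (2 * L%:R)^-1)%R.
have L2 : (0 < (2 * L%:R : R)^-1 <= 2^-1)%R.
  rewrite invr_gt0 mulr_gt0//= ?lef_pV2 ?posrE ?mulr_gt0//; lra.
have q01 : (2^-1 <= q < 1)%R.
  by case/andP: L2 => h1 h2; rewrite /q; apply/andP; split; lra.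
have qL : (2^-1 <= q ^+ L)%R.
  have bern (m : nat) : (1 - m%:R * (2 * L%:R)^-1 <= q ^+ m)%R.
    elim: m => [|m IH]; first by rewrite mul0r subr0 expr0.
    rewrite exprS; apply: (@le_trans _ _ (q * (1 - m%:R * (2 * L%:R)^-1))%R); last first.
      by rewrite ler_wpM2l//; case/andP: q01; lra.
    rewrite /q -natr1; have := ler0n R m; case/andP: L2; move: (2 * L%:R)^-1%R => z; nra.
  apply: le_trans (bern L); rewrite le_eqVlt; apply/orP; left; apply/eqP; field.
  by rewrite pnatr_eq0 -lt0n.
rewrite integral_rdf//.
have ug j : unit_fun (iter j (@fmax R n) (\1_F)).
  by elim: j => [|j IH] /=; [exact: unit_indic|exact: unit_fmax].
have lb j : level_bound q (kappa ^+ j * (2 * t)) (iter j (@fmax R n) (\1_F)).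
  elim: j => [|j IH].
    rewrite expr0 mul1r; apply: level_bound_indic => //.
    by case/andP: q01; lra.
  have := level_bound_fmax q01 (ug j) IH.
  rewrite (_ : 8 * _ * _ * _ = kappa ^+ j.+1 * (2 * t))%R//.
  rewrite /q opprB addrC subrK invrK exprS /kappa; ring.
have B0 : (0 < B)%R by lra.
rewrite Ft -EFinM; apply: nneseries_le => [j|N].
  rewrite mule_ge0// ?lee_fin ?exprn_ge0 ?invr_ge0 ?(ltW B0)//.
  by apply: integral_ge0 => x _; rewrite lee_fin; have /andP[] := (ug j).2 x.
(* Term j is at most B^-j (t + 2 kappa^j 2t). Both geometric sums are at most 2, whence 2t + 8t =
   10t. *)
apply: (@le_trans _ _ (\sum_(0 <= j < N) (t * B^-1 ^+ j + 4 * t * 2^-1 ^+ j)%:E)).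
  apply: lee_sum => j _.
  apply: (@le_trans _ _ ((B^-1 ^+ j)%:E * (t + 2 * (kappa ^+ j * (2 * t)))%:E)).
    apply: lee_wpmul2l; first by rewrite lee_fin exprn_ge0 ?invr_ge0 ?(ltW B0).
    apply: (integral_level_bound (ug j) _ qL) => //; last by rewrite EFinM -Ft.
    by case/andP: q01; lra.
  rewrite -EFinM lee_fin le_eqVlt; apply/orP; left; apply/eqP.
  by rewrite Bkj; ring.
rewrite sumEFin lee_fin big_split/= -!mulr_sumr.
have g1 : (\sum_(0 <= j < N) B^-1 ^+ j <= 2)%R.
  apply: geometric_half_le; rewrite invr_ge0 (ltW B0)/= lef_pV2 ?posrE//.
have g2 : (\sum_(0 <= j < N) 2^-1 ^+ j <= 2 :> R)%R.
  by apply: geometric_half_le; rewrite invr_ge0 lexx ler0n.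
by nra.
Qed.

End A1_weights.

(** * Admissible functions *)

Section admissible.
Variables (R : realType) (phi : \bar R -> \bar R).
Hypothesis hphi : admissible phi.

Definition phiR (x : R) : R := fine (phi x%:E).

Local Notation f := phiR.

Lemma admissible_fin (x : R) : (1 <= x)%R -> phi x%:E = (f x)%:E.
Proof.
case: hphi => _ _ _ [ga [be [_ _ H]]] x1.
by have [fx _] := H x x1; rewrite /phiR fineK.
Qed.

Lemma admissible_ge1 (x : R) : (1 <= x)%R -> (1 <= f x)%R.
Proof.
by move=> x1; case: hphi => H _ _ _; rewrite -lee_fin -admissible_fin// H.
Qed.

(** For x > 1 the ball of radius x - 1 around x stays in the half-line, so the restricted quotient
    is the usual one. This makes the mean value theorem available. *)
Lemma is_derive_ge1_interior (g : R -> R) (x d : R) : (1 < x)%R ->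
  is_derive_ge1 g x d -> is_derive x (1%R : R) g d.
Proof.
move=> x1 gd.
have H : h^-1 *: (g (h *: 1 + x) - g x)%R @[h --> 0%R^'] --> d.
  have : (h + x)%R @[h --> (0 : R)%R^'] --> within `[1%R, +oo[ x^'.
    move=> A /=; rewrite /within/= => /nbhs_ballP[e /= e0 He].
    apply/nbhs_ballP; exists (Num.min e (x - 1))%R => /=.
      by rewrite lt_min e0 subr_gt0.
    move=> h; rewrite /ball/= sub0r normrN lt_min => /andP[he hx] h0.
    apply: He => /=.
    - by rewrite /ball/= opprD addrC subrK normrN.
    - by rewrite -subr_eq0 addrK.
    - rewrite in_itv/= andbT; move: hx; rewrite ltr_norml => /andP[]; lra.
  move=> hx; have := @cvg_comp _ _ _ (fun h => h + x)%R (fun y => (g y - g x) / (y - x))%R _ _ _ hx gd.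
  apply: cvg_trans; apply: near_eq_cvg.
  by near=> h => /=; rewrite addrK [h *: _]mulr1 mulrC.
have dg : derivable g x 1%R by apply/cvg_ex; exists d.
by split => //; apply/cvg_lim.
Unshelve. all: by end_near.
Qed.

(** Mean value theorem: the derivative at the intermediate point c lies between 0 and be f(c)/c, and
    then f(c) <= f(b) by the monotonicity just obtained, while 1/c <= 1/a. *)
Lemma admissible_increment : exists2 be : R, (0 < be)%R &
  forall a b : R, (1 < a)%R -> (a < b)%R ->
    (f a <= f b)%R /\ (f b - f a <= be * f b * ((b - a) / a))%R.
Proof.
case: hphi => _ _ _ [ga [be [ga0 be0 H]]]; exists be => //.
have /choice[df Hdf] : forall x : R, exists d : R, (1 < x)%R -> is_derive x (1%R : R) f d /\
    (0 <= d <= be / x * f x)%R.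
  move=> x; have [x1|x1] := ltP 1%R x; last by exists 0%R.
  have [fx [d [dP /andP[d1 d2]]]] := H x (ltW x1); exists d => _.
  have x0 : (0 < x)%R by lra.
  have f0 : (0 < f x)%R by have := admissible_ge1 (ltW x1); lra.
  split; first exact: is_derive_ge1_interior.
  rewrite -ler_pdivrMr//; move: d1 d2; rewrite -/(f x) => d1 ->; rewrite andbT.
  have : (0 <= d / f x)%R by apply: le_trans d1; rewrite divr_ge0// ltW.
  by rewrite pmulr_lge0// invr_gt0.
have mvt (a b : R) : (1 < a)%R -> (a < b)%R ->
    exists2 c, (a < c < b)%R & (f b - f a = df c * (b - a))%R.
  move=> a1 ab; have := @MVT R f df a b ab.
  have dx (x : R) : (1 < x)%R -> is_derive x (1%R : R) f (df x) by move=> /Hdf[].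
  case=> [x||c].
  - by rewrite in_itv/= => /andP[ax _]; apply: dx; lra.
  - apply: derivable_within_continuous => x; rewrite in_itv/= => /andP[ax _].
    by have [] := dx x (lt_le_trans a1 ax).
  - by rewrite in_itv/= => cab E; exists c.
have mono (a b : R) : (1 < a)%R -> (a < b)%R -> (f a <= f b)%R.
  move=> a1 ab; have [c /andP[ac cb] E] := mvt _ _ a1 ab.
  have /Hdf[_ /andP[d0 _]] : (1 < c)%R by lra.
  by rewrite -subr_ge0 E mulr_ge0// subr_ge0 ltW.
move=> a b a1 ab; split; first exact: mono.
have [c /andP[ac cb] ->] := mvt _ _ a1 ab.
have c1 : (1 < c)%R by lra.
have [_ /andP[d0 d1]] := Hdf c c1.
rewrite [leRHS]mulrCA mulrC; apply: ler_wpM2l; first by rewrite subr_ge0 ltW.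
apply: (le_trans d1); rewrite mulrAC.
have fcb : (f c <= f b)%R by exact: mono.
have fc0 : (0 < f c)%R by have := admissible_ge1 (ltW c1); lra.
apply: ler_pM; rewrite ?mulr_ge0 ?invr_ge0 ?(ltW be0) ?(ltW fc0)//.
- by lra.
- by rewrite ler_wpM2l ?(ltW be0).
- by rewrite lef_pV2 ?posrE; lra.
Qed.

(** The increments settle a > 1; at a = 1 the value is 1, the least that phi takes. *)
Lemma admissible_mono (a b : R) : (1 <= a)%R -> (a <= b)%R -> (f a <= f b)%R.
Proof.
move=> a1 ab; have [b1|b1] := eqVneq a b; first by rewrite b1.
have {}ab : (a < b)%R by rewrite lt_neqAle b1.
have [a1'|a1'] := eqVneq a 1%R.
  rewrite a1'; have -> : f 1 = 1%R by case: hphi => _ E _ _; rewrite /phiR E.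
  by apply: admissible_ge1; lra.
have [be _ H] := admissible_increment.
by have [] := H a b _ ab; rewrite // lt_neqAle eq_sym a1'.
Qed.

(** A dilation by 1 + 1/(2 be) raises f by at most half of its new value, hence at most doubles it;
    enough such dilations exceed the factor [c]. *)
Lemma admissible_doubling (c : R) : (1 <= c)%R ->
  exists2 D : R, (0 < D)%R & forall x, (1 <= x)%R -> (f (c * x) <= D * f x)%R.
Proof.
move=> c1; have [be be0 H] := admissible_increment.
pose de : R := ((2 * be)^-1)%R.
have de0 : (0 < de)%R by rewrite invr_gt0 mulr_gt0.
have bede : (be * de = 2^-1)%R by rewrite /de invfM mulrCA divff ?mulr1// gt_eqF.
have step x : (1 < x)%R -> (f ((1 + de) * x) <= 2 * f x)%R.
  move=> x1; have x0 : (0 < x)%R by lra.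
  have xy : (x < (1 + de) * x)%R by rewrite ltr_pMl// ltrDl.
  have [_] := H _ _ x1 xy.
  have -> : (((1 + de) * x - x) / x = de)%R by field; rewrite gt_eqF.
  by rewrite mulrAC bede; lra.
have stepk k x : (1 < x)%R -> (f ((1 + de) ^+ k * x) <= 2 ^+ k * f x)%R.
  move=> x1; elim: k => [|k IH]; first by rewrite !expr0 !mul1r.
  rewrite !exprS -!mulrA; apply: (le_trans (step _ _)).
    apply: (lt_le_trans x1); rewrite ler_peMl; lra || (rewrite ?exprn_ege1//; lra).
  by rewrite ler_wpM2l.
have [k ck] : exists k, (c <= (1 + de) ^+ k)%R.
  exists (Num.truncn (c / de)).+1.
  have bern (m : nat) : (1 + m%:R * de <= (1 + de) ^+ m)%R.
    elim: m => [|m IH]; first by rewrite mul0r addr0 expr0.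
    rewrite exprS; apply: (@le_trans _ _ ((1 + de) * (1 + m%:R * de))%R); last first.
      by rewrite ler_wpM2l//; lra.
    by rewrite -natr1; have := ler0n R m; nra.
  apply: le_trans (bern _).
  have : (c / de <= (Num.truncn (c / de)).+1%:R)%R by rewrite ltW// truncnS_gt.
  by rewrite ler_pdivrMr//; lra.
exists (2 ^+ k + f (2 * c))%R.
  by rewrite ltr_wpDr ?exprn_gt0//; have := @admissible_ge1 (2 * c)%R; lra.
move=> x x1; have fx1 := admissible_ge1 x1.
have f2c : (1 <= f (2 * c))%R by apply: admissible_ge1; lra.
have k0 : (0 < 2 ^+ k :> R)%R by rewrite exprn_gt0.
(* The dilation steps require x > 1; on [1, 2[ the constant f(2c) is used instead, as f x >= 1. *)
have [x2|x2] := leP 2%R x.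
  apply: (@le_trans _ _ (f ((1 + de) ^+ k * x))).
    apply: admissible_mono; first by nra.
    by rewrite ler_wpM2r//; lra.
  by apply: (le_trans (stepk _ _ _)); nra.
apply: (@le_trans _ _ (f (2 * c))); last by nra.
by apply: admissible_mono; nra.
Qed.
End admissible.

(** * Decreasing rearrangements *)

Section step_functions.
Context d (T : measurableType d) (R : realType).
Variable mu : {measure set T -> \bar R}.

(** A lower sum over disjoint pieces: pointwise, at most one term of the step function is nonzero.
    It serves to discretize both integrals of the theorem. *)
Lemma step_le_integral (D : set T) (h : T -> \bar R) (J : nat -> set T)
    (c : nat -> R) (N : nat) :
  (forall s, D s -> 0 <= h s) -> (forall j, measurable (J j)) ->
  trivIset setT J -> (forall j, J j `<=` D) -> (forall j, 0 <= c j)%R ->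
  (forall j s, J j s -> (c j)%:E <= h s) ->
  \sum_(0 <= j < N) (c j)%:E * mu (J j) <= \int[mu]_(s in D) h s.
Proof.
move=> h0 mJ tJ JD c0 ch.
have mJ1 j : measurable_fun setT (fun s => (\1_(J j) s : R)%:E).
  exact/measurable_EFinP/measurable_indic.
apply: (@le_trans _ _ (\int[mu]_(s in D `|` setT)
    \sum_(0 <= j < N) (c j)%:E * (\1_(J j) s)%:E)); last first.
  rewrite [leRHS]integral_mkcond setUT; apply: ge0_le_integral_nomeas => // s _.
  - by rewrite patchE; case: ifPn => // /set_mem/h0.
  - by apply: sume_ge0 => j _; rewrite -EFinM lee_fin mulr_ge0.
  have [[j [jN Jjs]]|noj] := pselect (exists j, (j < N)%N /\ J j s).
    rewrite big_mkord (bigD1 (Ordinal jN))//= big1 => [|i ij].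
      by rewrite adde0 indicE mem_set// mule1 patchE mem_set; [exact: ch|exact: JD Jjs].
    rewrite indicE memNset ?mule0// => Jis; move/eqP : ij; apply; apply: val_inj => /=.
    by apply: tJ => //; exists s.
  rewrite big_nat big1 => [|j /= jN].
    by rewrite patchE; case: ifPn => // /set_mem/h0.
  by rewrite indicE memNset ?mule0// => Jjs; apply: noj; exists j.
rewrite setUT ge0_integral_sum//; last first.
- by move=> j s _; rewrite -EFinM lee_fin mulr_ge0.
- by move=> j; exact: measurable_funeM.
apply: lee_sum => j _; rewrite ge0_integralZl_EFin//.
by rewrite integral_indic// setIT.
Qed.

End step_functions.

Section rearrangement.
Variables (R : realType) (n : nat).
Local Notation E := (Rn R n).
Local Notation mu := (vol R n).

Lemma rearr_ge0 (g : E -> \bar R) t : 0 <= rearr g t.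
Proof.
by apply: le_ereal_inf_tmp => _ [s [s0 _] <-]; rewrite lee_fin ltW.
Qed.

Lemma rearr_nincr (g : E -> \bar R) s t : (s <= t)%R -> rearr g t <= rearr g s.
Proof.
move=> st; apply: ereal_inf_le_tmp => _ [r [r0 rs] <-]; exists r => //; split => //.
by rewrite (le_trans rs)// lee_fin.
Qed.

Lemma measurable_gt_norm (g : E -> \bar R) (y : R) : measurable_fun setT g ->
  measurable [set x | y%:E < `|g x|].
Proof.
move=> mg; rewrite -[X in measurable X]setTI; apply: emeasurable_fun_o_infty => //.
exact: measurableT_comp.
Qed.

(** Right continuity of the distribution function: the sets above y + 1/(k+1) increase to the set
    above y, and each has measure at most [t]. Thus the infimum defining [rearr] satisfies its own
    constraint. *)
Lemma rearr_le_distr (g : E -> \bar R) t (y : R) : measurable_fun setT g ->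
  rearr g t <= y%:E -> mu [set x | y%:E < `|g x|] <= t%:E.
Proof.
move=> mg gy.
pose S (k : nat) : set E := [set x | (y + k.+1%:R^-1)%:E < `|g x|].
have -> : [set x | y%:E < `|g x|] = \bigcup_k S k.
  apply/seteqP; split=> x /=; last first.
    by move=> [k _]; apply: le_lt_trans; rewrite lee_fin lerDl.
  case E : `|g x| => [r| |//]; last by move=> _; exists 0%N => //; rewrite /S/mkset E ltry.
  by rewrite lte_fin => /ltr_add_invr[k yk]; exists k => //; rewrite /S/mkset E lte_fin.
have mS k : measurable (S k) by exact: measurable_gt_norm.
have cS : mu \o S @ \oo --> mu (\bigcup_k S k).
  apply: nondecreasing_cvg_mu => //; first exact: bigcupT_measurable.
  move=> i j ij; apply/subsetPset => x; rewrite /S/=; apply: le_lt_trans.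
  by rewrite lee_fin lerD2l lef_pV2 ?posrE// ler_nat.
rewrite -(cvg_lim _ cS)//; apply: lime_le; first by apply/cvg_ex; exists (mu (\bigcup_k S k)).
apply: nearW => k /=.
have : rearr g t < (y + k.+1%:R^-1)%:E by rewrite (le_lt_trans gy)// lte_fin ltrDl.
move=> /ereal_inf_lt[_ [s [s0 sS] <-]]; rewrite lte_fin => sy.
apply: le_trans sS; apply: le_measure; rewrite ?inE//.
  exact: measurable_gt_norm.
by move=> x; apply: lt_trans; rewrite lte_fin.
Qed.

(** Passing to y + e supplies the positive height that [rearr] asks for, also when y = 0. *)
Lemma rearr_le (g : E -> \bar R) t (y : R) : (0 <= y)%R ->
  (forall z, (y < z)%R -> mu [set x | z%:E < `|g x|] <= t%:E) ->
  rearr g t <= y%:E.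
Proof.
move=> y0 H; apply/lee_addgt0Pr => e e0; rewrite -EFinD.
apply: ereal_inf_lbound; exists (y + e)%R => //; split; last by apply: H; rewrite ltrDl.
by rewrite ltr_wpDl.
Qed.

Section finite_rearrangement.
Variables (f : E -> R) (t : R).
Hypotheses (mf : measurable_fun setT f) (t0 : (0 < t)%R).
Local Notation mleb := (@lebesgue_measure R).

Let r s := rearr (EFin \o f) s.
Let I0 := \int[mleb]_(s in `]0%R, t[) r s.
Hypothesis I0oo : I0 < +oo.

(** By monotonicity an infinite value at [s] would persist on the whole interval from 0 to min s t,
    making [I0] infinite. *)
Lemma rearr_fin_num s : (0 < s)%R -> r s \is a fin_num.
Proof.
move=> s0; rewrite ge0_fin_numE ?rearr_ge0// ltey; apply/eqP => rs.
pose s' := Num.min s t.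
have s'0 : (0 < s')%R by rewrite lt_min s0.
suff : +oo <= I0 by rewrite leye_eq => /eqP I0E; move: I0oo; rewrite I0E.
have -> : +oo = \int[mleb]_(x in `]0%R, s'[) cst +oo x :> \bar R.
  rewrite integral_cst//= lebesgue_measure_itv/= lte_fin s'0 sube0.
  by rewrite gt0_mulye// lte_fin.
apply: ge0_le_integral_nomeas => // x.
- by move=> /=; rewrite !in_itv/= => /andP[-> xs']; rewrite (lt_le_trans xs')// ge_min lexx orbT.
- by move=> _; exact: rearr_ge0.
- by move=> _; rewrite le0y.
- rewrite /= in_itv/= => /andP[_ xs']; rewrite -rs; apply: rearr_nincr.
  by rewrite ltW// (lt_le_trans xs')// ge_min lexx.
Qed.

(* Junk value [0] where the rearrangement is infinite, which [I0oo] excludes. *)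
Definition fr s : R := fine (r s).

Lemma frE s : (0 < s)%R -> rearr (EFin \o f) s = (fr s)%:E.
Proof. by move=> s0; rewrite fineK// rearr_fin_num. Qed.

Lemma fr_ge0 s : (0 <= fr s)%R.
Proof. by rewrite fine_ge0// rearr_ge0. Qed.

Lemma fr_nincr s s' : (0 < s)%R -> (s <= s')%R -> (fr s' <= fr s)%R.
Proof.
move=> s0 ss'; rewrite -lee_fin -!frE ?(lt_le_trans s0 ss')//.
exact: rearr_nincr.
Qed.

Lemma distr_fr s : (0 < s)%R -> mu [set x | (fr s < `|f x|)%R] <= s%:E.
Proof.
move=> s0; have := @rearr_le_distr (EFin \o f) s (fr s).
rewrite (_ : [set x | (fr s)%:E < `|(EFin \o f) x|] = [set x | (fr s < `|f x|)%R]).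
  apply; last by rewrite frE.
  exact/measurable_EFinP.
by apply/seteqP; split=> x /=; rewrite lte_fin.
Qed.

Lemma fr_le_I0 : (t * fr t)%:E <= I0.
Proof.
have -> : (t * fr t)%:E = \int[mleb]_(x in `]0%R, t[) cst (fr t)%:E x.
  by rewrite integral_cst//= lebesgue_measure_itv/= lte_fin t0 sube0 -EFinM mulrC.
apply: ge0_le_integral_nomeas => // x /=; rewrite ?in_itv/=.
- by move=> _; exact: rearr_ge0.
- by move=> _; rewrite lee_fin fr_ge0.
- by move=> /andP[x0 xt]; rewrite /r frE// lee_fin fr_nincr// ltW.
Qed.

(** The term with value at t 2^-(j+1) is charged to the interval just to the left of that point,
    where the rearrangement is larger; its length t 2^-(j+2) accounts for the factor 4. *)
Lemma dyadic_le_I0 (N : nat) :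
  \sum_(0 <= j < N) (t * 2^-1 ^+ j * fr (t * 2^-1 ^+ j.+1))%:E <= 4%:E * I0.
Proof.
pose J j : set R := `]t * 2^-1 ^+ j.+2, t * 2^-1 ^+ j.+1[%classic%R.
have p0 (j : nat) : (0 < 2^-1 ^+ j :> R)%R by rewrite exprn_gt0.
have p1 (i j : nat) : (i <= j)%N -> (t * 2^-1 ^+ j <= t * 2^-1 ^+ i :> R)%R.
  move=> ij; rewrite ler_pM2l// ler_wiXn2l// ?invr_ge0//.
  by rewrite invf_le1// ler1n.
apply: (@le_trans _ _ (4%:E * \sum_(0 <= j < N) (fr (t * 2^-1 ^+ j.+1))%:E * mleb (J j))).
  rewrite ge0_sume_distrr; last by move=> j _; rewrite mule_ge0// lee_fin fr_ge0.
  apply: lee_sum => j _; rewrite /J lebesgue_measure_itv/= lte_fin.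
  have -> : (t * 2^-1 ^+ j.+2 < t * 2^-1 ^+ j.+1)%R.
    by rewrite ltr_pM2l// exprS gtr_pMl// invf_lt1// ltr1n.
  rewrite -EFinB -!EFinM lee_fin !exprS le_eqVlt; apply/orP; left; apply/eqP.
  by field.
apply: lee_wpmul2l; first by rewrite lee_fin.
apply: step_le_integral => //.
- by move=> s _; exact: rearr_ge0.
- by move=> j; exact: measurable_itv.
- move=> i j _ _ [s []]; rewrite /J/= !in_itv/= => /andP[i1 i2] /andP[j1 j2].
  apply/eqP; rewrite eqn_leq; apply/andP; split; rewrite leqNgt; apply/negP => ij.
    have := p1 _ _ (ij : (j.+2 <= i.+1)%N); lra.
  have := p1 _ _ (ij : (i.+2 <= j.+1)%N); lra.
- move=> j s; rewrite /J/= !in_itv/= => /andP[s1 s2].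
  have := p0 j.+2; have := p1 0%N j.+1 isT; rewrite expr0 mulr1 => h1 h2.
  apply/andP; split; last by lra.
  by apply: lt_trans s1; rewrite mulr_gt0.
- by move=> j; exact: fr_ge0.
- move=> j s; rewrite /J/= !in_itv/= => /andP[s1 s2].
  have s0 : (0 < s)%R by apply: lt_trans s1; rewrite mulr_gt0.
  by rewrite /r frE// lee_fin fr_nincr// ltW.
Qed.

(* Almost everywhere on [{|f| > fr t}], |f| lies between two consecutive values
   of the rearrangement at the dyadic points [t / 2 ^ j]. *)
Lemma integral_top_le (g : E -> R) : measurable_fun setT g ->
  (forall x, `|g x| <= `|f x|)%R -> (forall x, (`|f x| <= fr t)%R -> g x = 0%R) ->
  \int[mu]_x `|g x|%:E <= 4%:E * I0.
Proof.
move=> mg gf g0.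
pose A j : set E := [set x | (fr (t * 2^-1 ^+ j) < `|f x|)%R].
have p0 (j : nat) : (0 < t * 2^-1 ^+ j :> R)%R by rewrite mulr_gt0// exprn_gt0.
have mA j : measurable (A j).
  rewrite (_ : A j = [set x | (fr (t * 2^-1 ^+ j))%:E < `|(EFin \o f) x|]).
    by apply: measurable_gt_norm; exact/measurable_EFinP.
  by apply/seteqP; split=> x; rewrite /A/= lte_fin.
have mT j : measurable_fun setT (fun x => (fr (t * 2^-1 ^+ j.+1))%:E * (\1_(A j) x : R)%:E).
  by apply: measurable_funeM; exact/measurable_EFinP/measurable_indic.
have T0 j x : 0 <= (fr (t * 2^-1 ^+ j.+1))%:E * (\1_(A j) x : R)%:E.
  by rewrite -EFinM lee_fin mulr_ge0// fr_ge0.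
apply: (@le_trans _ _ (\int[mu]_x
   \sum_(j <oo) (fr (t * 2^-1 ^+ j.+1))%:E * (\1_(A j) x)%:E)); last first.
  rewrite integral_nneseries//; apply: nneseries_le => [j|N].
    by apply: integral_ge0.
  apply: le_trans (dyadic_le_I0 N); apply: lee_sum => j _.
  rewrite ge0_integralZl_EFin ?fr_ge0//; last first.
    exact/measurable_EFinP/measurable_indic.
  rewrite integral_indic// setIT EFinM muleC.
  apply: lee_wpmul2r; first by rewrite lee_fin fr_ge0.
  exact: distr_fr.
apply: ae_ge0_le_integral => //.
- by apply/measurable_EFinP; exact: measurableT_comp.
- by move=> x _; exact: nneseries_ge0.
- by apply: ge0_emeasurable_sum.
(* Exceptional set: |f| exceeds the rearrangement at every dyadic point, so its measure is at most t
   2^-j for every j. *)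
exists (\bigcap_j A j); split.
- exact: bigcapT_measurable.
- apply/eqP; rewrite -measure_le0; apply/lee_addgt0Pr => e e0; rewrite add0e.
  have [j je] : exists j, (t * 2^-1 ^+ j <= e)%R.
    exists (Num.truncn (t / e)).+1; have := truncnS_gt (t / e)%R.
    rewrite ltr_pdivrMr// => /ltW te.
    rewrite exprVn ler_pdivrMr ?exprn_gt0// (le_trans te)// mulrC ler_wpM2l ?(ltW e0)//.
    by rewrite -natrX ler_nat ltnW// ltn_expl.
  apply: (@le_trans _ _ (mu (A j))).
    by apply: le_measure; rewrite ?inE//; [exact: bigcapT_measurable|exact: bigcap_inf].
  by apply: (le_trans (distr_fr (p0 j))); rewrite lee_fin.
move=> x; apply: contra_notP => xA _.
have [fx|fx] := leP `|f x|%R (fr t).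
  by rewrite g0// normr0; exact: nneseries_ge0.
(* The last level still exceeded by |f x|; term j of the series then dominates |f x|. *)
have [j [Aj nAj]] : exists j, A j x /\ ~ A j.+1 x.
  apply: contrapT => H; apply: xA => j _; elim: j => [|j IH].
    by rewrite /A/= expr0 mulr1.
  by apply: contrapT => nA; apply: H; exists j.
apply: le_trans (nneseries_lim_ge j.+1 _); last by [].
rewrite big_nat_recr//=; apply: (@le_trans _ _ ((fr (t * 2^-1 ^+ j.+1))%:E * (\1_(A j) x)%:E)).
  rewrite indicE mem_set// mule1 lee_fin (le_trans (gf x))// leNgt.
  exact/negP.
by rewrite leeDr// sume_ge0.
Qed.

End finite_rearrangement.
End rearrangement.

(** * The second integral in dyadic form *)

(** Cauchy condensation: the block from 2^m to 2^(m+1) has 2^m terms, each at least F(2^m) / 2^(m+1)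
    times the value of [w] at the last index; the ratio 1/2 is the factor 2. *)
Lemma dyadic_block_le (R : realType) (F w : nat -> R) (M : nat) :
  {homo F : i j / (i <= j)%N >-> (i <= j)%R} ->
  (forall i j, (0 < i)%N -> (i <= j)%N -> w j <= w i)%R ->
  (forall i, 0 <= F i)%R -> (forall i, 0 <= w i)%R ->
  (\sum_(0 <= m < M) F (2 ^ m)%N * w (2 ^ m.+1 - 1)%N <=
   2 * \sum_(1 <= i < 2 ^ M) F i.+1 / i.+1%:R * w i)%R.
Proof.
move=> Fnd wni F0 w0; elim: M => [|M IH]; first by rewrite !big_nil mulr0.
have MM : (2 ^ M <= 2 ^ M.+1)%N by rewrite leq_exp2l.
have M1 : (1 <= 2 ^ M)%N by rewrite expn_gt0.
rewrite big_nat_recr//= (big_cat_nat M1 MM)/= mulrDr; apply: lerD => //.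
apply: (@le_trans _ _ (2 * \sum_(2 ^ M <= i < 2 ^ M.+1)
    (F (2 ^ M)%N / (2 ^ M.+1)%:R * w (2 ^ M.+1 - 1)%N)))%R.
  rewrite big_const_nat iter_addr_0 expnS mul2n -addnn addnK.
  set c := (_ / _ * _)%R; rewrite -[(c *+ _)%R]mulr_natr /c.
  have p0 : (0 < (2 ^ M)%:R :> R)%R by rewrite ltr0n expn_gt0.
  rewrite natrD le_eqVlt; apply/orP; left; apply/eqP.
  by field; lra.
rewrite ler_wpM2l// [leLHS]big_nat [leRHS]big_nat; apply: ler_sum => i /andP[i1 i2].
have i0 : (0 < i)%N by exact: leq_trans i1.
rewrite ler_pM ?divr_ge0//.
  rewrite ler_pM ?invr_ge0//; first by apply: Fnd; exact: leqW.
  by rewrite lef_pV2 ?posrE ?ltr0n ?expn_gt0// ler_nat.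
by apply: wni => //; rewrite leq_subRL ?expn_gt0// add1n.
Qed.

Section tail_integral.
Variables (R : realType) (n : nat) (phi : \bar R -> \bar R).
Hypothesis hphi : admissible phi.
Local Notation E := (Rn R n).
Local Notation mleb := (@lebesgue_measure R).
Local Notation Phi := (phiR phi).
Variables (f : E -> R) (t : R).
Hypothesis t0 : (0 < t)%R.
Hypothesis I0oo : \int[mleb]_(s in `]0%R, t[) rearr (EFin \o f) s < +oo.

Let I1 := \int[mleb]_(s in `]t, +oo[)
  ((1 + ln (s / t))^-1%:E * phi (1 + ln (s / t))%:E
   * rearr (EFin \o f) s * s^-1%:E).

Lemma ln2_bounds : (2^-1 <= ln (2 : R) <= 1)%R.
Proof.
have := @le_ln1Dx R 1%R; have := @le_ln1Dx R (- 2^-1)%R.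
have -> : (1 - 2^-1 = 2^-1 :> R)%R by lra.
rewrite lnV ?posrE// => h1 h2.
have {}h1 : (- ln 2 <= - 2^-1 :> R)%R by apply: h1; lra.
have {}h2 : (ln (1 + 1) <= 1 :> R)%R by apply: h2; lra.
by apply/andP; split; [lra|exact: h2].
Qed.

(** For s between t 2^j and t 2^(j+1), log(s/t) lies between j/2 and j + 1. Hence 1 + log(s/t) <= j
    + 2 <= 4 (1 + log(s/t)), and doubling compares phi at the two arguments. *)
Lemma tail_sum_le (D : R) (N : nat) : (0 < D)%R ->
  (forall x, (1 <= x)%R -> (Phi (4 * x) <= D * Phi x)%R) ->
  \sum_(0 <= j < N) (Phi j.+2%:R / j.+2%:R * fr f (t * 2 ^+ j.+1))%:E <=
  (2 * D)%:E * I1.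
Proof.
move=> D0 HD.
pose J j : set R := `]t * 2 ^+ j, t * 2 ^+ j.+1[%classic%R.
have p0 (j : nat) : (0 < 2 ^+ j :> R)%R by rewrite exprn_gt0.
have p1 (i j : nat) : (i <= j)%N -> (t * 2 ^+ i <= t * 2 ^+ j :> R)%R.
  by move=> ij; rewrite ler_pM2l// ler_weXn2l// ler1n.
(* Lower bound of the integrand on [J j], with 1/s replaced by its value at the right end; times the
   length t 2^j it loses the factor 2 D. *)
pose c j : R := (Phi j.+2%:R / j.+2%:R * fr f (t * 2 ^+ j.+1) / (D * (t * 2 ^+ j.+1)))%R.
have P1 j : (1 <= Phi j.+2%:R)%R by apply: admissible_ge1 => //; rewrite ler1n.
have c0 j : (0 <= c j)%R.
  rewrite /c divr_ge0 ?mulr_ge0 ?fr_ge0 ?(ltW D0) ?(ltW t0) ?(ltW (p0 _))//.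
  by have := P1 j; lra.
have JS j s : J j s -> (t * 2 ^+ j < s < t * 2 ^+ j.+1)%R by rewrite /J/= in_itv.
have st (s : R) : (t < s)%R ->
    [/\ (1 <= 1 + ln (s / t))%R, (0 <= s^-1)%R & (0 <= (1 + ln (s / t))^-1)%R].
  move=> ts; have l0 : (0 <= ln (s / t))%R.
    by rewrite ln_ge0// ler_pdivlMr// mul1r ltW.
  by split; rewrite ?invr_ge0; move: t0; lra.
apply: (@le_trans _ _ ((2 * D)%:E * \sum_(0 <= j < N) (c j)%:E * mleb (J j))).
  rewrite ge0_sume_distrr; last by move=> j _; rewrite mule_ge0// lee_fin c0.
  apply: lee_sum => j _; rewrite /J lebesgue_measure_itv/= lte_fin.
  have -> : (t * 2 ^+ j < t * 2 ^+ j.+1)%R.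
    by rewrite ltr_pM2l// exprS ltr_pMl// ltr1n.
  rewrite -EFinB -!EFinM lee_fin /c !exprS le_eqVlt; apply/orP; left; apply/eqP.
  have pj := p0 j.
  by field; rewrite (gt_eqF pj) (gt_eqF t0) (gt_eqF D0) -natrD pnatr_eq0.
apply: lee_wpmul2l; first by rewrite lee_fin mulr_ge0// ltW.
apply: step_le_integral => //.
- move=> s /=; rewrite in_itv/= andbT => /st[h si li].
  have h0 : 0 <= phi (1 + ln (s / t))%:E.
    by rewrite (admissible_fin hphi h) lee_fin (le_trans ler01)// admissible_ge1.
  by rewrite !mule_ge0 ?rearr_ge0 ?lee_fin.
- by move=> j; exact: measurable_itv.
- move=> i j _ _ [s [/JS /andP[i1 i2] /JS /andP[j1 j2]]].
  apply/eqP; rewrite eqn_leq; apply/andP; split; rewrite leqNgt; apply/negP => ij.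
    have := p1 _ _ ij; lra.
  have := p1 _ _ ij; lra.
- move=> j s /JS /andP[h1 h2] /=; rewrite in_itv/= andbT.
  by have := p1 0%N j isT; rewrite expr0 mulr1; lra.
move=> j s /JS /andP[h1 h2].
have := p1 0%N j isT; rewrite expr0 mulr1 => h3.
have ts : (t < s)%R by lra.
have s0 : (0 < s)%R by exact: lt_trans ts.
have lns : (j%:R * ln 2 <= ln (s / t) <= j.+1%:R * ln 2)%R.
  rewrite !mulr_natl -!lnXn//.
  have st0 : (0 < s / t)%R by rewrite divr_gt0.
  by rewrite !ler_ln ?posrE// ler_pdivlMr// ler_pdivrMr// ![(_ * t)%R]mulrC !ltW.
have /andP[l1 l2] := ln2_bounds.
have j0 := ler0n R j.
set l := ln (s / t) in lns *.
have /andP[l3 l4] := lns.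
have lj : (j%:R * 2^-1 <= l)%R by apply: le_trans l3; rewrite ler_wpM2l.
have lj' : (l <= j.+1%:R)%R by apply: (le_trans l4); rewrite ler_piMr.
have [h1l _ _] := st s ts; rewrite -/l in h1l.
rewrite (admissible_fin hphi h1l) (frE t0 I0oo s0) -!EFinM lee_fin.
have j2 : (j.+2%:R = j%:R + 2 :> R)%R by rewrite -addn2 natrD.
have j1 : (j.+1%:R = j%:R + 1 :> R)%R by rewrite -addn1 natrD.
have PD : (Phi j.+2%:R <= D * Phi (1 + l))%R.
  apply: le_trans (HD _ _); last by lra.
  by apply: admissible_mono => //; rewrite j2; lra.
have fs : (fr f (t * 2 ^+ j.+1) <= fr f s)%R by apply: (fr_nincr t0 I0oo) => //; exact: ltW.
have f0 : (0 <= fr f (t * 2 ^+ j.+1))%R by exact: fr_ge0.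
have -> : c j = (j.+2%:R^-1 * (Phi j.+2%:R / D) * fr f (t * 2 ^+ j.+1) * (t * 2 ^+ j.+1)^-1)%R.
  rewrite /c; have pj := p0 j.+1; move: (2 ^+ j.+1)%R pj => z z0.
  by field; rewrite (gt_eqF z0) (gt_eqF t0) (gt_eqF D0) -natrD pnatr_eq0.
have Pj := P1 j.
have s1 : (0 < t * 2 ^+ j.+1)%R by rewrite mulr_gt0.
apply: ler_pM; rewrite ?mulr_ge0 ?invr_ge0 ?(ltW s1) ?(ltW D0) ?fr_ge0//; try lra.
  apply: ler_pM; rewrite ?mulr_ge0 ?invr_ge0 ?(ltW D0)//; try lra.
  apply: ler_pM; rewrite ?mulr_ge0 ?invr_ge0 ?(ltW D0)//; try lra.
    by rewrite lef_pV2 ?posrE ?ltr0n//; lra.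
  by rewrite ler_pdivrMr// mulrC.
by rewrite lef_pV2 ?posrE//; exact: ltW.
Qed.

(** Condensation of [tail_sum_le]: only the heights at t 2^(2^(m+1) - 1) survive, each with the full
    weight phi(2^m) of its block. *)
Lemma layer_sum_le (D : R) (M : nat) : (0 < D)%R ->
  (forall x, (1 <= x)%R -> (Phi (4 * x) <= D * Phi x)%R) ->
  (\sum_(0 <= m < M) Phi (2 ^+ m) * fr f (t * 2 ^+ (2 ^ m.+1 - 1)))%:E <=
  (4 * D)%:E * I1.
Proof.
move=> D0 HD.
(* The maximum with 1 keeps the argument in the domain of phi at index 0. *)
pose F i := Phi (maxn 1 i)%:R; pose w i := fr f (t * 2 ^+ i)%R.
have F1 i : (1 <= F i)%R by apply: admissible_ge1; rewrite // ler1n leq_maxl.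
have Fnd : {homo F : i j / (i <= j)%N >-> (i <= j)%R}.
  move=> i j ij; apply: admissible_mono => //; first by rewrite ler1n leq_maxl.
  by rewrite ler_nat geq_max leq_maxl/= leq_max ij orbT.
have wni i j : (0 < i)%N -> (i <= j)%N -> (w j <= w i)%R.
  move=> _ ij; apply: (fr_nincr t0 I0oo); first by rewrite mulr_gt0// exprn_gt0.
  by rewrite ler_pM2l// ler_weXn2l// ler1n.
have := dyadic_block_le M Fnd wni (fun i => le_trans ler01 (F1 i)) (fun i => fr_ge0 f _).
rewrite -lee_fin => H; apply: le_trans (le_trans _ H) _.
  rewrite lee_fin le_eqVlt; apply/orP; left; apply/eqP; apply: eq_bigr => m _.
  by rewrite /F /w (maxn_idPr _) ?expn_gt0// natrX.
rewrite big_add1 EFinM.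
apply: (@le_trans _ _ (2%:E * ((2 * D)%:E * I1))); last first.
  by rewrite muleA -EFinM mulrA -natrM.
apply: lee_wpmul2l; first by rewrite lee_fin.
apply: le_trans (tail_sum_le _ D0 HD); rewrite sumEFin lee_fin.
rewrite le_eqVlt; apply/orP; left; apply/eqP; apply: eq_bigr => j _.
by rewrite /F /w (maxn_idPr _).
Qed.
End tail_integral.

(** * Weighted estimates for the operator *)

Lemma cvge0_lt (R : realType) (u : nat -> \bar R) (d : \bar R) :
  u @ \oo --> 0 -> 0 < d -> exists m, u m < d.
Proof.
move=> u0 d0; apply: contrapT => H; suff : d <= 0 by rewrite leNgt d0.
rewrite -(cvg_lim _ u0)//; apply: lime_ge; first by apply/cvg_ex; exists 0.
by apply: nearW => m; rewrite leNgt; apply/negP => um; apply: H; exists m.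
Qed.

(** The values of f are kept or dropped, never capped, so the pieces over a partition of the heights
    add up to f exactly. *)
Definition piece (R : realType) (n : nat) (f : Rn R n -> R) (i : interval R)
  (x : Rn R n) : R := if `|f x|%R \in i then f x else 0%R.

Section operator.
Variables (R : realType) (n : nat).
Local Notation E := (Rn R n).
Local Notation mu := (vol R n).

Lemma measurable_piece (f : E -> R) (i : interval R) : measurable_fun setT f ->
  measurable_fun setT (piece f i).
Proof.
move=> mf.
have -> : piece f i = (f \* \1_((Num.norm \o f) @^-1` [set` i]))%R.
  apply/funext => x; rewrite /piece/= indicE; case: ifPn => fi.
    by rewrite mem_set ?mulr1.
  by rewrite memNset ?mulr0//; exact/negP.
apply: measurable_funM; first exact: mf.
apply: measurable_indic; rewrite -[X in measurable X]setTI.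
by apply: (measurableT_comp (@normr_measurable R setT) mf) => //; exact: measurable_itv.
Qed.

Lemma le_piece (f : E -> R) (i : interval R) x : (`|piece f i x| <= `|f x|)%R.
Proof. by rewrite /piece; case: ifPn => // _; rewrite normr0. Qed.

Lemma A1_domain_le (f g : E -> R) : A1_domain f -> measurable_fun setT g ->
  (forall x, `|g x| <= `|f x|)%R -> A1_domain g.
Proof.
move=> [mf [u Au fu]] mg gf; split => //; exists u => //.
apply: le_lt_trans fu; have [[_ u0 _] _ _] := Au.
by apply: ge0_le_integral_nomeas => // x _; rewrite lee_fin ?mulr_ge0// ler_wpM2r.
Qed.

Lemma A1_domain_piece (f : E -> R) (i : interval R) :
  A1_domain f -> A1_domain (piece f i).
Proof.
move=> Af; apply: (A1_domain_le Af) => [|x]; last exact: le_piece.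
by apply: measurable_piece; case: Af.
Qed.

(** A superlevel set of T g may have infinite measure, whereas the weight is built on a set of
    finite measure; sigma-finiteness provides one. *)
Lemma exists_sub_finite (S : set E) (t : R) : measurable S -> t%:E < mu S ->
  exists F : set E, [/\ measurable F, F `<=` S, t%:E < mu F & mu F < +oo].
Proof.
move=> mS tS.
have /sigma_finiteP[G [GT ndG mG]] := @vol_sigma_finite R n.
have mSG k : measurable (S `&` G k) by apply: measurableI => //; have [] := mG k.
have SE : \bigcup_k (S `&` G k) = S by rewrite -setI_bigcupr -GT setIT.
have cS : mu \o (fun k => S `&` G k) @ \oo --> mu S.
  rewrite -[in X in _ --> X]SE; apply: nondecreasing_cvg_mu => //.
    by rewrite SE.
  by move=> i j ij; apply/subsetPset; apply: setIS; apply/subsetPset; exact: ndG.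
have [k tk] : exists k, t%:E < mu (S `&` G k).
  apply: contrapT => H; suff : mu S <= t%:E by rewrite leNgt tS.
  rewrite -(cvg_lim _ cS)//; apply: lime_le; first by apply/cvg_ex; exists (mu S).
  by apply: nearW => k /=; rewrite leNgt; apply/negP => tk; apply: H; exists k.
exists (S `&` G k); split => //.
have [mGk] := mG k; apply: le_lt_trans.
by apply: le_measure; rewrite ?inE.
Qed.

Variables (phi : \bar R -> \bar R) (T : (E -> R) -> (E -> \bar R)).
Hypotheses (hphi : admissible phi) (hT : sublinear T) (hTphi : A1_weak_bounded T phi).

Lemma measurable_T_gt (g : E -> R) (y : R) : A1_domain g ->
  measurable [set x | y%:E < `|T g x|].
Proof. by move=> Ag; apply: measurable_gt_norm; case: hT => H _ _; exact: H. Qed.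

Lemma phi_A1_norm (u : E -> R) (c : R) : A1 u -> A1_norm u <= c%:E ->
  phi (A1_norm u) <= (phiR phi c)%:E.
Proof.
move=> Au uc; have u1 := A1_norm_ge1 Au.
have [a Ea] : exists a, A1_norm u = a%:E.
  exists (fine (A1_norm u)); rewrite fineK// fin_numElt.
  by rewrite (lt_le_trans _ u1) ?ltNyr// (le_lt_trans uc)// ltry.
rewrite Ea !lee_fin in u1 uc *.
by rewrite (admissible_fin hphi u1) lee_fin admissible_mono.
Qed.

(** The set F is found only inside the superlevel set, so the estimate on g is required for all such
    pairs F, u and in proportion to mu F. As u >= 1 on F, the weighted inequality reads y mu F <=
    phi(32 * 3^n L) X mu F, and mu F cancels. *)
Lemma layer_bound (g : E -> R) (L : nat) (X t y : R) : A1_domain g ->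
  (0 < t)%R -> (0 < L)%N -> (0 <= X)%R ->
  (forall (F : set E) (u : E -> R), measurable F -> t%:E < mu F -> mu F < +oo ->
    measurable_fun setT u -> (forall x, 0 <= u x <= 2)%R ->
    (forall A : set E, measurable A -> mu A <= (2 ^+ L)%:E * mu F ->
      \int[mu]_(x in A) (u x)%:E <= 10%:E * mu F) ->
    L1_norm u g <= X%:E * mu F) ->
  (phiR phi (32 * 3 ^+ n * L%:R) * X < y)%R ->
  mu [set x | y%:E < `|T g x|] <= t%:E.
Proof.
move=> Ag t0 L0 X0 H Xy; rewrite leNgt; apply/negP => tS.
set S := [set x | _] in tS.
have mS : measurable S by exact: measurable_T_gt.
have [F [mF FS tF Foo]] := exists_sub_finite mS tS.
have F0 : 0 < mu F by apply: lt_trans tF; rewrite lte_fin.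
have [u [Au uL u2 uF uA]] := exists_A1_weight mF F0 Foo L0.
have mu' : measurable_fun setT u by case: Au => -[].
have gX := H F u mF tF Foo mu' u2 uA.
have K1 : (1 <= 32 * 3 ^+ n * L%:R :> R)%R.
  have : (1 <= L%:R :> R)%R by rewrite ler1n.
  by have : (1 <= 3 ^+ n :> R)%R by [rewrite exprn_ege1// ler1n|]; nra.
have P1 := admissible_ge1 hphi K1.
have y0 : (0 < y)%R by apply: le_lt_trans Xy; rewrite mulr_ge0//; lra.
have [m Fm] : exists m, mu F = m%:E by exists (fine (mu F)); rewrite fineK// ge0_fin_numE.
have m0 : (0 < m)%R by rewrite -lte_fin -Fm.
have : y%:E * mu F <= (phiR phi (32 * 3 ^+ n * L%:R))%:E * (X%:E * mu F).
  apply: (@le_trans _ _ (phi (A1_norm u) * L1_norm u g)); last first.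
    apply: le_trans (lee_wpmul2r _ (phi_A1_norm Au uL)) _.
      by apply: integral_ge0 => x _; rewrite lee_fin mulr_ge0//; case/andP: (u2 x).
    by apply: lee_wpmul2l => //; rewrite lee_fin; lra.
  have mg : measurable_fun setT g by case: Ag.
  have goo : L1_norm u g < +oo by apply: (le_lt_trans gX); rewrite Fm -EFinM ltry.
  apply: le_trans (hTphi Au mg goo).
  apply: (@le_trans _ _ (y%:E * wmeasure u S)); last first.
    by apply: ereal_sup_ubound; exists y.
  apply: lee_wpmul2l; first by rewrite lee_fin ltW.
  have -> : mu F = \int[mu]_(x in F) cst 1%:E x by rewrite (integral_cst mu mF 1%:E) mul1e.
  apply: ge0_le_integral_nomeas => // x _.
  by rewrite lee_fin; case/andP: (u2 x).
rewrite Fm muleA lee_pmul2r ?lte_fin// -EFinM lee_fin.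
by move=> /(lt_le_trans Xy); rewrite ltxx.
Qed.

(** [F] confines only the second term, which will carry the remainder, known to be small only on
    sets of finite measure. The null set where subadditivity fails is added to the covering. *)
Lemma T_split (g h : E -> R) (F : set E) (a b : R) : A1_domain g -> A1_domain h ->
  A1_domain (g \+ h)%R -> measurable F ->
  mu (F `&` [set x | (a + b)%:E < `|T (g \+ h)%R x|]) <=
  mu [set x | a%:E < `|T g x|] + mu (F `&` [set x | b%:E < `|T h x|]).
Proof.
move=> Ag Ah Agh mF; have [_ /(_ g h Ag Ah)[N [mN N0 HN]] _] := hT.
have mg := measurable_T_gt a Ag; have mh := measurable_T_gt b Ah.
have mFh : measurable (F `&` [set x | b%:E < `|T h x|]) by exact: measurableI.
have mgh := measurable_T_gt (a + b) Agh.
rewrite -[leRHS]adde0 -[X in _ + _ + X]N0.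
apply: le_trans (leeD (measureU2 mu mg mFh) (lexx (mu N))).
apply: le_trans (measureU2 mu (measurableU _ _ mg mFh) mN).
apply: le_measure; rewrite ?inE.
- exact: measurableI.
- by apply: measurableU => //; exact: measurableU.
move=> x [Fx xgh]; have [xN|xN] := pselect (N x); [by right|left].
have : `|T (g \+ h)%R x| <= `|T g x| + `|T h x|.
  by apply: contrapT => nx; apply: xN; exact: HN.
move=> xle; have [ag|ga] := ltP a%:E `|T g x|; [by left|right; split => //=].
rewrite ltNge; apply/negP => hb; move: xgh => /=; rewrite ltNge => /negP; apply.
by apply: (le_trans xle); rewrite EFinD leeD.
Qed.

(** Dominated convergence with dominating function |f| w; pointwise the integrand is at most
    [lam k * w x]. *)
Lemma L1_norm_truncation_cvg0 (f w : E -> R) (lam : nat -> R) :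
  measurable_fun setT f -> measurable_fun setT w -> (forall x, 0 <= w x)%R ->
  L1_norm w f < +oo -> (forall k, 0 <= lam k)%R -> lam @ \oo --> (0 : R)%R ->
  (fun k => L1_norm w (piece f `]-oo, lam k])) @ \oo --> (0 : \bar R).
Proof.
move=> mf mw w0 fw lam0 laml.
pose r k := piece f `]-oo, lam k].
have rlam k x : (`|r k x| <= lam k)%R.
  by rewrite /r /piece; case: ifPn; rewrite ?in_itv//= normr0.
have mr k : measurable_fun setT (r k) by exact: measurable_piece.
have mrw k : measurable_fun setT (fun x => (`|r k x| * w x)%:E).
  apply/measurable_EFinP; apply: measurable_funM; last exact: mw.
  exact: (measurableT_comp (@normr_measurable R setT) (mr k)).
have mfw : measurable_fun setT (fun x => (`|f x| * w x)%:E).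
  apply/measurable_EFinP; apply: measurable_funM; last exact: mw.
  exact: (measurableT_comp (@normr_measurable R setT) mf).
have -> : (0 : \bar R) = \int[mu]_x cst 0 x by rewrite integral0.
apply: (@dominated_cvg _ _ _ mu setT measurableT _ _ (fun x => (`|f x| * w x)%:E)) => //.
- move=> x _; apply/fine_cvgP; split; first by apply: nearW.
  apply: (@squeeze_cvgr _ _ _ _ (cst 0%R) (fun k => lam k * w x)%R) => //.
  + apply: nearW => k; apply/andP; split => /=; first by rewrite mulr_ge0.
    by apply: ler_wpM2r; [exact: w0|exact: rlam].
  + exact: cvg_cst.
  + by rewrite -[X in _ --> X](mul0r (w x)); apply: cvgMl.
- apply/integrableP; split => //; apply: le_lt_trans fw.
  by apply: ge0_le_integral_nomeas => // x _; rewrite ?lee_fin ?mulr_ge0// ger0_norm// mulr_ge0.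
- move=> k x _ /=; rewrite lee_fin ger0_norm ?mulr_ge0//.
  by rewrite ler_wpM2r// le_piece.
Qed.

(** The sets decrease to a null set as w > 0 almost everywhere, and finiteness of mu F gives
    continuity from above. *)
Lemma small_where_small (w : E -> R) (F : set E) (d : R) :
  measurable_fun setT w -> {ae mu, forall x, (0 < w x)%R} ->
  measurable F -> mu F < +oo -> (0 < d)%R ->
  exists m : nat, mu (F `&` [set x | (w x <= m.+1%:R^-1)%R]) <= d%:E.
Proof.
move=> mw wpos mF Foo d0.
pose A (m : nat) : set E := F `&` [set x | (w x <= m.+1%:R^-1)%R].
have mA m : measurable (A m).
  apply: measurableI => //; rewrite -[X in measurable X]setTI.
  rewrite (_ : [set x | _] = w @^-1` `]-oo, m.+1%:R^-1]%classic%R).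
    by apply: mw => //; exact: measurable_itv.
  by apply/seteqP; split=> x /=; rewrite in_itv.
have cA : mu \o A @ \oo --> mu (\bigcap_m A m).
  apply: nonincreasing_cvg_mu => //.
  - by apply: le_lt_trans Foo; apply: le_measure; rewrite ?inE//; exact: subIsetl.
  - exact: bigcapT_measurable.
  - move=> i j ij; apply/subsetPset; apply: setIS => x /= /le_trans; apply.
    by rewrite lef_pV2 ?posrE// ler_nat.
have A0 : mu (\bigcap_m A m) = 0.
  have [N [mN N0 HN]] := wpos.
  apply/eqP; rewrite -measure_le0 -N0; apply: le_measure; rewrite ?inE//.
    exact: bigcapT_measurable.
  move=> x Ax; apply: HN => /= wx.
  have [m] := ltr_add_invr wx; rewrite add0r => mx.
  by have [_ /=] := Ax m I; rewrite leNgt mx.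
rewrite A0 in cA; have : 0 < d%:E :> \bar R by rewrite lte_fin.
by move=> /(cvge0_lt cA)[m /ltW]; exists m.
Qed.

(* [f] is integrable against some [w] in [A_1], and [w > 0] a.e.: convergence in
   [w]-measure on a set of finite measure gives convergence in measure. *)
Lemma tail_vanish (f : E -> R) (F : set E) (lam : nat -> R) (e de : R) :
  A1_domain f -> measurable F -> mu F < +oo -> (forall k, 0 <= lam k)%R ->
  lam @ \oo --> (0 : R)%R -> (0 < e)%R -> (0 < de)%R ->
  exists k : nat,
    mu (F `&` [set x | e%:E < `|T (piece f `]-oo, lam k]) x|]) <= de%:E.
Proof.
move=> Af mF Foo lam0 laml e0 de0; have [mf [w Aw fw]] := Af.
have [[mw w0 _] _ [c wc]] := Aw.
have c1 := A1_bound_ge1 Aw wc.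
have P1 : (1 <= phiR phi c)%R by exact: admissible_ge1.
have phiw := phi_A1_norm Aw (A1_norm_le wc).
have wpos := A1_gt0 Aw.
pose r k := piece f `]-oo, lam k].
have mr k : measurable_fun setT (r k) by exact: measurable_piece.
have cvI := L1_norm_truncation_cvg0 mf mw w0 fw lam0 laml.
have de2 : (0 < de / 2)%R by rewrite divr_gt0.
have [m Am] := small_where_small mw wpos mF Foo de2.
pose A : set E := F `&` [set x | (w x <= m.+1%:R^-1)%R].
have mA : measurable A.
  apply: measurableI => //; rewrite -[X in measurable X]setTI.
  rewrite (_ : [set x | _] = w @^-1` `]-oo, m.+1%:R^-1]%classic%R).
    by apply: mw => //; exact: measurable_itv.
  by apply/seteqP; split=> x /=; rewrite in_itv.
(* Chosen so that (m + 1) phi(c) eta / e = de / 2. *)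
pose eta : R := (e * (de / 2) / (phiR phi c * m.+1%:R))%R.
have eta0 : (0 < eta)%R.
  by rewrite /eta divr_gt0 ?mulr_gt0 ?divr_gt0//; lra.
have [k kI] : exists k, L1_norm w (r k) < eta%:E.
  have : 0 < eta%:E :> \bar R by rewrite lte_fin.
  by move=> /(cvge0_lt cvI)[k]; exists k.
exists k; set G := [set x | e%:E < `|T (r k) x|].
have Ar : A1_domain (r k) by exact: A1_domain_piece.
have mG : measurable G by exact: measurable_T_gt.
have wG : e%:E * wmeasure w G <= (phiR phi c)%:E * eta%:E.
  apply: (@le_trans _ _ (phi (A1_norm w) * L1_norm w (r k))).
    apply: le_trans (hTphi Aw (mr k) _); last by rewrite (lt_trans kI)// ltry.
    by apply: ereal_sup_ubound; exists e.
  apply: le_trans (lee_wpmul2r _ phiw) _.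
    by apply: integral_ge0 => x _; rewrite lee_fin mulr_ge0.
  by apply: lee_wpmul2l; [rewrite lee_fin; lra|exact: ltW].
(* Off [A] the weight exceeds 1/(m+1), so mu B is at most m + 1 times the w-measure of [G]. *)
pose B := (F `&` G) `\` A.
have mB : measurable B by apply: measurableD => //; exact: measurableI.
have muB : mu B <= (de / 2)%:E.
  have : (m.+1%:R^-1)%:E * mu B <= wmeasure w G.
    have -> : (m.+1%:R^-1)%:E * mu B = \int[mu]_(x in B) cst (m.+1%:R^-1)%:E x.
      by rewrite (integral_cst mu mB (m.+1%:R^-1)%:E).
    apply: ge0_le_integral_nomeas.
    - by move=> x [[]].
    - by move=> x _; rewrite lee_fin.
    - by move=> x _; rewrite lee_fin.
    - by move=> x [[Fx _] nA]; rewrite lee_fin leNgt; apply/negP => wx; apply: nA; split => //=; exact: ltW.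
  move=> H; have : e%:E * ((m.+1%:R^-1)%:E * mu B) <= (phiR phi c)%:E * eta%:E.
    by apply: le_trans wG; apply: lee_wpmul2l => //; rewrite lee_fin ltW.
  have em : (0 < e * m.+1%:R^-1)%R by rewrite divr_gt0.
  rewrite muleA -!EFinM -lee_pdivlMl// => /le_trans; apply.
  rewrite -EFinM lee_fin /eta le_eqVlt; apply/orP; left; apply/eqP.
  by field; rewrite ?gt_eqF//; lra.
apply: (@le_trans _ _ (mu (A) + mu B)).
  apply: le_trans (measureU2 mu (mA) mB); apply: le_measure; rewrite ?inE.
  - exact: measurableI.
  - exact: measurableU.
  - by move=> x FGx; have [Ax|nAx] := pselect (A x); [left|right].
apply: (le_trans (leeD Am muB)); rewrite -EFinD lee_fin; lra.
Qed.

End operator.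

(** * Decomposition into layers *)

Section decomposition.
Variables (R : realType) (n : nat).
Local Notation E := (Rn R n).
Local Notation mu := (vol R n).
Local Notation mleb := (@lebesgue_measure R).
Variables (phi : \bar R -> \bar R) (T : (E -> R) -> (E -> \bar R)).
Hypotheses (hphi : admissible phi) (hT : sublinear T) (hTphi : A1_weak_bounded T phi).
Variables (f : E -> R) (t : R).
Hypotheses (Af : A1_domain f) (t0 : (0 < t)%R).

Let I0 := \int[mleb]_(s in `]0%R, t[) rearr (EFin \o f) s.
Hypothesis I0oo : I0 < +oo.

Let mf : measurable_fun setT f. Proof. by case: Af. Qed.

(** The [- 1] gives s_0 = t and aligns s_(m+1) with the last index of the m-th block in
    [dyadic_block_le]. *)
Let sk (k : nat) : R := (t * 2 ^+ (2 ^ k - 1))%R.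

Let sk0 k : (0 < sk k)%R.
Proof. by rewrite mulr_gt0// exprn_gt0. Qed.

Let sk_nd k : (sk k <= sk k.+1)%R.
Proof.
by rewrite ler_pM2l// ler_weXn2l ?ler1n// leq_sub2r// leq_exp2l.
Qed.

Let lam k := fr f (sk k).

Let lam0 k : (0 <= lam k)%R. Proof. exact: fr_ge0. Qed.

Let lam_ni k : (lam k.+1 <= lam k)%R.
Proof. exact: (fr_nincr t0 I0oo). Qed.

Let layer k := piece f `]lam k.+1, lam k].
Let rest k := piece f `]-oo, lam k].

Lemma rest_split k : rest k = (layer k \+ rest k.+1)%R.
Proof.
apply/funext => x; rewrite /rest /layer /piece/= !in_itv/=.
have := lam_ni k; case: (leP `|f x|%R (lam k.+1)) => h1; case: (leP `|f x|%R (lam k)) => h2 h3;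
  rewrite ?add0r ?addr0//.
by have := lt_le_trans h2 (le_trans h1 h3); rewrite ltxx.
Qed.

Lemma top_split : f = (piece f `]lam 0%N, +oo[ \+ rest 0%N)%R.
Proof.
apply/funext => x; rewrite /rest /piece/= !in_itv/= andbT.
by case: (leP `|f x|%R (lam 0%N)); rewrite ?add0r ?addr0.
Qed.

(** The layer is supported where |f| > lam (k+1), a set of measure at most s_(k+1). The choice L =
    2^(k+3) is large enough because 2^(k+1) - 1 + (k + 3) <= 2^(k+3). *)
Lemma integral_layer_le k (F : set E) (u : E -> R) : measurable F ->
  (t * 2^-1 ^+ k.+3)%:E < mu F -> measurable_fun setT u ->
  (forall x, 0 <= u x <= 2)%R ->
  (forall A : set E, measurable A -> mu A <= (2 ^+ (2 ^ k.+3))%:E * mu F ->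
      \int[mu]_(x in A) (u x)%:E <= 10%:E * mu F) ->
  L1_norm u (layer k) <= (10 * lam k)%:E * mu F.
Proof.
move=> mF tF mu' u2 uA.
pose A : set E := [set x | (lam k.+1 < `|f x|)%R].
have mA : measurable A.
  rewrite (_ : A = [set x | (lam k.+1)%:E < `|(EFin \o f) x|]).
    by apply: measurable_gt_norm; exact/measurable_EFinP.
  by apply/seteqP; split=> x; rewrite /A/= lte_fin.
have AF : mu A <= (2 ^+ (2 ^ k.+3))%:E * mu F.
  apply: (le_trans (distr_fr mf t0 I0oo (sk0 k.+1))).
  apply: (@le_trans _ _ ((2 ^+ (2 ^ k.+3))%:E * (t * 2^-1 ^+ k.+3)%:E)).
    rewrite -EFinM lee_fin mulrCA ler_pM2l// exprVn ler_pdivlMr ?exprn_gt0//.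
    rewrite -exprD ler_weXn2l ?ler1n//.
    have : (k.+2 <= 2 ^ k.+1)%N.
      elim: k {tF uA A mA} => // k IH; rewrite expnS.
      by rewrite mul2n -addnn -[k.+3]addn1 leq_add// expn_gt0.
    have : (0 < 2 ^ k)%N by rewrite expn_gt0.
    rewrite !expnS; move: (2 ^ k)%N => z; lia.
  by apply: lee_wpmul2l; [rewrite lee_fin exprn_ge0|exact: ltW].
rewrite mulrC EFinM -muleA.
apply: (@le_trans _ _ ((lam k)%:E * \int[mu]_(x in A) (u x)%:E)); last first.
  by apply: lee_wpmul2l; [rewrite lee_fin|exact: uA].
rewrite -ge0_integralZl_EFin; last 4 first.
- exact: mA.
- by move=> x _; rewrite lee_fin; case/andP: (u2 x).
- by apply/measurable_EFinP; exact: (measurable_funS measurableT).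
- exact: lam0.
rewrite /L1_norm [leRHS]integral_mkcond.
have u0 x : (0 <= u x)%R by case/andP: (u2 x).
have uk0 x : 0 <= (lam k)%:E * (u x)%:E by rewrite -EFinM lee_fin mulr_ge0.
apply: ge0_le_integral_nomeas => // x _.
- by rewrite patchE; case: ifPn.
- by rewrite lee_fin mulr_ge0.
rewrite patchE /layer /piece in_itv/=; case: ifPn => [/andP[h1 h2]|_].
  by rewrite mem_set// -EFinM lee_fin ler_wpM2r.
by rewrite normr0 mul0r; case: ifPn.
Qed.

(** Bounding u by 2 gives 2 * 4 * i0, which equals (32 i0 / t)(t / 4), and t / 4 < mu F. *)
Lemma integral_top_layer_le (F : set E) (u : E -> R) (i0 : R) : I0 = i0%:E ->
  (t / 4)%:E < mu F -> (forall x, 0 <= u x <= 2)%R ->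
  L1_norm u (piece f `]lam 0%N, +oo[) <= (32 * i0 / t)%:E * mu F.
Proof.
move=> I0E tF u2; set g := piece f _.
have mg : measurable_fun setT g by exact: measurable_piece.
have H : \int[mu]_x `|g x|%:E <= 4%:E * I0.
  apply: (integral_top_le mf t0 I0oo mg) => [x|x fx]; first exact: le_piece.
  rewrite /g /piece in_itv/= andbT /lam /sk subnn expr0 mulr1.
  by rewrite ltNge fx.
apply: (@le_trans _ _ (2%:E * \int[mu]_x `|g x|%:E)).
  rewrite -ge0_integralZl_EFin; last 4 first.
  - exact: measurableT.
  - by move=> x _; rewrite lee_fin.
  - apply/measurable_EFinP; exact: (measurableT_comp (@normr_measurable R setT) mg).
  - exact: ler0n.
  apply: ge0_le_integral_nomeas => // x _; have /andP[h1 h2] := u2 x.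
    by rewrite lee_fin mulr_ge0.
  by rewrite -EFinM lee_fin mulrC ler_wpM2r.
have i00 : (0 <= i0)%R.
  by rewrite -lee_fin -I0E; apply: integral_ge0 => s _; exact: rearr_ge0.
apply: (@le_trans _ _ (2%:E * (4%:E * I0))).
  by apply: lee_wpmul2l; rewrite ?lee_fin.
apply: (@le_trans _ _ ((32 * i0 / t)%:E * (t / 4)%:E)).
  rewrite I0E -!EFinM lee_fin le_eqVlt; apply/orP; left; apply/eqP.
  by field; rewrite (gt_eqF t0).
apply: lee_wpmul2l; last exact: ltW.
by rewrite lee_fin divr_ge0 ?mulr_ge0 ?(ltW t0).
Qed.

Lemma T_layers (F : set E) (a : nat -> R) (b : R) (N : nat) : measurable F ->
  mu (F `&` [set x | (\sum_(0 <= k < N) a k + b)%:E < `|T (rest 0%N) x|]) <=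
  \sum_(0 <= k < N) mu [set x | (a k)%:E < `|T (layer k) x|] +
  mu (F `&` [set x | b%:E < `|T (rest N) x|]).
Proof.
move=> mF; elim: N b => [|N IH] b; first by rewrite !big_nil add0r add0e.
have Ap i : A1_domain (piece f i) by exact: A1_domain_piece.
rewrite !big_nat_recr//= -[X in (X)%:E]addrA -addeA.
apply: (le_trans (IH _)); apply: leeD => //.
rewrite (rest_split N).
apply: (T_split hT); [exact: Ap|exact: Ap| |exact: mF].
by rewrite -rest_split; exact: Ap.
Qed.

Local Notation Phi := (phiR phi).

Let I1 := \int[mleb]_(s in `]t, +oo[)
  ((1 + ln (s / t))^-1%:E * phi (1 + ln (s / t))%:E
   * rearr (EFin \o f) s * s^-1%:E).

(** The weight with parameter L has A_1 constant at most kappa L. *)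
Let kappa : R := (32 * 3 ^+ n)%R.

Let kappa1 : (1 <= kappa)%R.
Proof.
by have : (1 <= 3 ^+ n :> R)%R; [rewrite exprn_ege1// ler1n|rewrite /kappa; lra].
Qed.

Variables (D D' i0 i1 : R).
Hypotheses (D0 : (0 < D)%R) (D'0 : (0 < D')%R).
Hypothesis HD : forall x, (1 <= x)%R -> (Phi (4 * x) <= D * Phi x)%R.
Hypothesis HD' : forall x, (1 <= x)%R -> (Phi (16 * kappa * x) <= D' * Phi x)%R.
Hypotheses (I0E : I0 = i0%:E) (I1E : I1 = i1%:E).

Let lam_sum N : (\sum_(0 <= m < N) Phi (2 ^+ m) * lam m.+1 <= 4 * D * i1)%R.
Proof.
have := layer_sum_le hphi t0 I0oo N D0 HD.
by rewrite -/I1 I1E -EFinM lee_fin.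
Qed.

Let lam0E : lam 0%N = fr f t.
Proof. by rewrite /lam /sk subnn expr0 mulr1. Qed.

Let lam0_le : (lam 0%N <= i0 / t)%R.
Proof.
have := fr_le_I0 t0 I0oo; rewrite -/I0 I0E lee_fin lam0E => h.
by rewrite ler_pdivlMr// mulrC.
Qed.

Let pow1 m : (1 <= 2 ^+ m :> R)%R.
Proof. by rewrite exprn_ege1// ler1n. Qed.

Let i1_ge0 : (0 <= i1)%R.
Proof.
have := lam_sum 0; rewrite big_nil => h.
by rewrite -(@pmulr_rge0 _ (4 * D)%R)// mulr_gt0.
Qed.

Let i0t_ge0 : (0 <= i0 / t)%R. Proof. exact: le_trans lam0_le. Qed.

(** As phi >= 1 and [lam] is nonincreasing, (k + 1) lam (k+1) is below the sum in [lam_sum], hence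
    bounded in k. *)
Lemma lam_cvg0 : lam @ \oo --> (0 : R)%R.
Proof.
have lam_le k : (k.+1%:R * lam k.+1 <= 4 * D * i1)%R.
  apply: le_trans (lam_sum k.+1).
  have -> : (k.+1%:R * lam k.+1 = \sum_(0 <= m < k.+1) lam k.+1)%R.
    by rewrite big_const_nat subn0 iter_addr_0 mulr_natl.
  rewrite [leLHS]big_nat [leRHS]big_nat; apply: ler_sum => m /= mk.
  have h : (lam k.+1 <= lam m.+1)%R.
    have : {homo lam : i j / (i <= j)%N >-> (j <= i)%R}.
      by apply: homo_leq => // x y z xy yz; exact: le_trans yz xy.
    by apply.
  apply: (le_trans h); rewrite ler_peMl//.
  exact: (admissible_ge1 hphi (pow1 m)).
rewrite -(cvg_shiftS lam).
apply: (@squeeze_cvgr _ _ _ _ (cst 0%R) (fun k => (4 * D * i1) * k.+1%:R^-1)%R).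
- apply: nearW => k; apply/andP; split; first exact: lam0.
  by rewrite /= ler_pdivlMr// mulrC; exact: lam_le.
- exact: cvg_cst.
- rewrite -[X in _ --> X](mulr0 (4 * D * i1)%R); apply: cvgMr.
  exact: cvg_harmonic.
Qed.

(** The threshold that [layer_bound] yields for L = 2^(k+3) and X = 10 lam k. *)
Let cost k : R := (Phi (kappa * (2 ^ k.+3)%:R) * (10 * lam k))%R.

(** Layer 0 is paid by the first integral, through lam 0 <= i0 / t. For k = m + 1 the argument kappa
    2^(m+4) = 16 kappa 2^m is reduced to 2^m by doubling, and phi(2^m) lam (m+1) is a term of
    [lam_sum]. *)
Let cost_sum N : (\sum_(0 <= k < N) cost k <=
  (10 * Phi (8 * kappa)) * (i0 / t) + 40 * D' * D * i1)%R.
Proof.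
have P8 : (1 <= Phi (8 * kappa))%R by apply: (admissible_ge1 hphi); move: kappa1; lra.
have t1 : (0 <= 40 * D' * D * i1)%R.
  by rewrite !mulr_ge0 ?(ltW D0) ?(ltW D'0).
have t2 : (0 <= (10 * Phi (8 * kappa)) * (i0 / t))%R.
  by rewrite mulr_ge0//; lra.
case: N => [|N]; first by rewrite big_nil addr_ge0.
rewrite big_nat_recl//; apply: lerD.
  rewrite /cost mulrCA mulrA.
  rewrite (_ : kappa * _ = 8 * kappa)%R; last by rewrite mulrC.
  by apply: ler_wpM2l => //; lra.
apply: (@le_trans _ _ (\sum_(0 <= m < N) (10 * D') * (Phi (2 ^+ m) * lam m.+1))%R).
  apply: ler_sum => m _; rewrite /cost mulrCA -!mulrA; apply: ler_wpM2l => //.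
  rewrite !mulrA; apply: ler_wpM2r => //.
  rewrite (_ : kappa * _ = 16 * kappa * 2 ^+ m)%R; last first.
    by rewrite natrX !exprS; ring.
  exact: (HD' (pow1 m)).
rewrite -mulr_sumr; apply: (@le_trans _ _ (10 * D' * (4 * D * i1))%R).
  by apply: ler_wpM2l => //; rewrite mulr_ge0 ?(ltW D'0).
by rewrite le_eqVlt; apply/orP; left; apply/eqP; ring.
Qed.

Lemma rearr_T_le : rearr (T f) t <=
  ((32 * Phi kappa + 10 * Phi (8 * kappa) + 40 * D' * D) * (i0 / t + i1))%:E.
Proof.
have P1 : (1 <= Phi kappa)%R by exact: (admissible_ge1 hphi).
have P8 : (1 <= Phi (8 * kappa))%R by apply: (admissible_ge1 hphi); move: kappa1; lra.
have DD : (0 < D' * D)%R by rewrite mulr_gt0.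
set y0 := (_ * (i0 / t + i1))%R.
have y0_ge0 : (0 <= y0)%R.
  have DD4 : (0 <= 40 * D' * D)%R by rewrite -mulrA mulr_ge0 ?(ltW DD).
  by rewrite /y0 mulr_ge0 ?addr_ge0//; lra.
apply: rearr_le => // z y0z; pose d : R := (z - y0)%R.
have d0 : (0 < d)%R by rewrite subr_gt0.
rewrite leNgt; apply/negP => tS; set S := [set x | _] in tS.
have mS : measurable S by exact: (measurable_T_gt hT).
have [F [mF FS tF Foo]] := exists_sub_finite mS tS.
have Ap i : A1_domain (piece f i) by exact: A1_domain_piece.
(* The gap d = z - y0 is spent as d/4 on the top, at most d/4 on all layers together and d/4 on the
   remainder; it also gives the strict inequality that [layer_bound] requires. *)
pose atop : R := (Phi kappa * (32 * i0 / t) + d / 4)%R.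
pose a k : R := (cost k + d / 8 * 2^-1 ^+ k)%R.
have d4 : (0 < d / 4)%R by rewrite divr_gt0.
have t2 : (0 < t / 2)%R by rewrite divr_gt0.
have [N HN] := tail_vanish hphi hT hTphi Af mF Foo lam0 lam_cvg0 d4 t2.
have Htop : mu [set x | atop%:E < `|T (piece f `]lam 0%N, +oo[) x|] <= (t / 4)%:E.
  apply: (@layer_bound _ _ phi T hphi hT hTphi _ 1 (32 * i0 / t)).
  - exact: Ap.
  - by rewrite divr_gt0.
  - by [].
  - by rewrite -mulrA mulr_ge0.
  - by move=> G u mG tG _ _ u2 _; exact: integral_top_layer_le.
  - by rewrite mulr1 /atop ltrDl.
have Hlay k : mu [set x | (a k)%:E < `|T (layer k) x|] <= (t * 2^-1 ^+ k.+3)%:E.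
  apply: (@layer_bound _ _ phi T hphi hT hTphi _ (2 ^ k.+3) (10 * lam k)).
  - exact: Ap.
  - by rewrite mulr_gt0// exprn_gt0.
  - by rewrite expn_gt0.
  - by rewrite mulr_ge0.
  - by move=> G u mG tG _ mu' u2 uA; exact: integral_layer_le.
  - by rewrite /a /cost ltrDl mulr_gt0 ?divr_gt0// exprn_gt0.
have thr : (atop + (\sum_(0 <= k < N) a k + d / 4) <= z)%R.
  have := cost_sum N; have := @geometric_half_le R 2^-1 N.
  rewrite /a big_split/= -mulr_sumr invr_ge0 ler0n lexx => /(_ isT) h1 h2.
  have -> : z = (y0 + d)%R by rewrite /d addrC subrK.
  have h3 : (d / 8 * \sum_(0 <= i < N) 2^-1 ^+ i <= d / 8 * 2)%R.
    by apply: ler_wpM2l => //; rewrite divr_ge0// ltW.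
  have q1 : (0 <= Phi kappa * i1)%R by rewrite mulr_ge0//; lra.
  have q2 : (0 <= Phi (8 * kappa) * i1)%R by rewrite mulr_ge0//; lra.
  have q3 : (0 <= D' * D * (i0 / t))%R by rewrite mulr_ge0// ltW.
  move: h2 h3; rewrite /atop /y0; move: (\sum_(0 <= k < N) cost k)%R => s1.
  move: (\sum_(0 <= k < N) _)%R => s2.
  have -> : (32 * i0 / t = 32 * (i0 / t))%R by rewrite mulrA.
  move: q1 q2 q3; move: (i0 / t)%R (Phi kappa) (Phi (8 * kappa)) => x p p8; lra.
have : mu F <= t%:E; last by rewrite leNgt tF.
(* Measure budget: t/4 for the top, at most t/4 for the sum of t 2^-(k+3) over the layers, t/2 for
   the remainder. *)
have -> : t%:E = (t / 4)%:E + ((t / 4)%:E + (t / 2)%:E).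
  by rewrite -!EFinD; congr EFin; lra.
apply: (@le_trans _ _ (mu (F `&`
    [set x | (atop + (\sum_(0 <= k < N) a k + d / 4))%:E < `|T f x|]))).
  apply: le_measure; rewrite ?inE//.
    by apply: measurableI => //; exact: (measurable_T_gt hT).
  move=> x Fx; split => //=; apply: le_lt_trans (FS x Fx).
  by rewrite lee_fin.
have := T_split hT atop (\sum_(0 <= k < N) a k + d / 4)%R
  (Ap `]lam 0%N, +oo[) (Ap `]-oo, lam 0%N]).
rewrite -top_split => /(_ _ Af mF) /le_trans; apply; apply: leeD => //.
apply: (le_trans (T_layers _ _ _ mF)); apply: leeD => //.
apply: (@le_trans _ _ (\sum_(0 <= k < N) (t / 8 * 2^-1 ^+ k)%:E)).
  apply: lee_sum => k _; apply: (le_trans (Hlay k)); rewrite lee_fin.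
  by rewrite le_eqVlt; apply/orP; left; apply/eqP; rewrite !exprS; field.
rewrite sumEFin lee_fin -mulr_sumr.
have := @geometric_half_le R 2^-1 N.
rewrite invr_ge0 ler0n lexx => /(_ isT) h1.
apply: (@le_trans _ _ (t / 8 * 2)%R).
  by apply: ler_wpM2l => //; rewrite divr_ge0// ltW.
lra.
Qed.

End decomposition.

(** * The constant, and the reduction to finite integrals *)

Theorem theorem1p2 (R : realType) (n : nat) (hn : (0 < n)%N)
    (phi : \bar R -> \bar R) (hphi : admissible phi)
    (T : (Rn R n -> R) -> (Rn R n -> \bar R))
    (hT : sublinear T) (hTphi : A1_weak_bounded T phi) :
  exists2 C : R, (0 < C)%R &
    forall t : R, (0 < t)%R ->
    forall f : Rn R n -> R, A1_domain f ->
      rearr (T f) t <=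
      C%:E * (t^-1%:E * \int[lebesgue_measure]_(s in `]0%R, t[)
                          rearr (EFin \o f) s
              + \int[lebesgue_measure]_(s in `]t, +oo[)
                  ((1 + ln (s / t))^-1%:E * phi (1 + ln (s / t))%:E
                   * rearr (EFin \o f) s * s^-1%:E)).
Proof.
pose kappa : R := (32 * 3 ^+ n)%R.
have kappa1 : (1 <= kappa)%R.
  by have : (1 <= 3 ^+ n :> R)%R; [rewrite exprn_ege1// ler1n|rewrite /kappa; lra].
have [D D0 HD] : exists2 D, (0 < D)%R &
    forall x, (1 <= x)%R -> (phiR phi (4 * x) <= D * phiR phi x)%R.
  by apply: (admissible_doubling hphi); lra.
have [D' D'0 HD'] : exists2 D', (0 < D')%R &
    forall x, (1 <= x)%R -> (phiR phi (16 * kappa * x) <= D' * phiR phi x)%R.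
  by apply: (admissible_doubling hphi); lra.
have P1 : (1 <= phiR phi kappa)%R by exact: (admissible_ge1 hphi).
have P8 : (1 <= phiR phi (8 * kappa))%R by apply: (admissible_ge1 hphi); lra.
exists (32 * phiR phi kappa + 10 * phiR phi (8 * kappa) + 40 * D' * D)%R.
  have : (0 < D' * D)%R by rewrite mulr_gt0.
  by rewrite -[(40 * D' * D)%R]mulrA; lra.
set C := (_ + _)%R.
have C0 : (0 < C)%R.
  have : (0 < D' * D)%R by rewrite mulr_gt0.
  by rewrite /C -[(40 * D' * D)%R]mulrA; lra.
move=> t t0 f Af.
set I0 := (X in t^-1%:E * X + _); set I1 := (X in _ * _ + X).
have I0_ge0 : 0 <= I0 by apply: integral_ge0 => s _; exact: rearr_ge0.
have I1_ge0 : 0 <= I1.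
  apply: integral_ge0 => s /=; rewrite in_itv/= andbT => ts.
  have l1 : (1 <= 1 + ln (s / t))%R.
    by rewrite lerDl ln_ge0// ler_pdivlMr// mul1r ltW.
  have p0 : 0 <= phi (1 + ln (s / t))%:E.
    by rewrite (admissible_fin hphi l1) lee_fin (le_trans ler01)// admissible_ge1.
  have s0 : (0 <= s^-1)%R by rewrite invr_ge0 ltW// (lt_trans t0).
  have l0 : (0 <= (1 + ln (s / t))^-1)%R by rewrite invr_ge0 (le_trans ler01).
  by rewrite !mule_ge0 ?rearr_ge0 ?lee_fin.
have ti0 : (0 < t^-1)%R by rewrite invr_gt0.
(* An infinite integral makes the right-hand side infinite, since C and 1/t are positive; otherwise
   both integrals are real numbers. *)
have [I0E|I0oo] := eqVneq I0 +oo.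
  by rewrite I0E gt0_muley ?lte_fin// addye ?gt0_muley ?lte_fin// ?leey// gt_eqF// (lt_le_trans _ I1_ge0)// ltNy0.
have {}I0oo : I0 < +oo by rewrite ltey.
have [I1E|I1oo] := eqVneq I1 +oo.
  rewrite I1E addey ?gt0_muley ?lte_fin ?leey//.
  by rewrite gt_eqF// (lt_le_trans _ (mule_ge0 _ I0_ge0)) ?ltNy0 ?lee_fin ?(ltW ti0).
have [i0 I0E] : exists i0, I0 = i0%:E.
  by exists (fine I0); rewrite fineK// ge0_fin_numE.
have [i1 I1E] : exists i1, I1 = i1%:E.
  by exists (fine I1); rewrite fineK// ge0_fin_numE// ltey.
rewrite I0E I1E -(EFinM t^-1) -EFinD -EFinM [(t^-1 * _)%R]mulrC.
exact: (rearr_T_le hphi hT hTphi Af t0 I0oo D0 D'0 HD HD' I0E I1E).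
Qed.
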